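(* For every integer $n\geq1$, $$\inf_{\alpha>0}\mathcal{G}_n(\alpha)=\eta_n,\qquad \operatorname*{argmin}_{\alpha>0}\mathcal{G}_n(\alpha)=\{h_n\},$$ $$\inf_{\alpha>0}\mathcal{R}_n(\alpha)=\eta_n,\qquad \operatorname*{argmin}_{\alpha>0}\mathcal{R}_n(\alpha)=\{h_n\}.$$
   Context: Norms are Euclidean. Constants. For $n\geq1$, $r_n\in(0,1)$ is the unique solution in $(0,1)$ of $r_n^n\bigl(1+n(1+r_n)\bigr)=1$. Set $h_n=1+r_n$ and $\eta_n=r_n^n=\frac{1}{1+nh_n}$. Smooth criterion. Fix $L>0$. For $\alpha>0$, $$\mathcal{G}_n(\alpha):=\sup\frac{\|\nabla f(x_n)\|}{L\|x_0-x_*\|},$$ where the supremum is over all dimensions $d\ge1$ and all triples $(f,x_0,x_* )$ with $f:\mathbb{R}^d\to\mathbb{R}$ convex and $L$-smooth (differentiable with $L$-Lipschitz gradient), $x_*\in\arg\min f$, and $x_0\neq x_*$, and $x_n$ is obtained after $n$ steps of gradient descent $x_{k+1}=x_k-\frac{\alpha}{L}\nabla f(x_k)$. Proximal criterion. Fix $\lambda>0$, and write $\operatorname{prox}_{\lambda F}(x)=\arg\min_z\{F(z)+\frac{1}{2\lambda}\|z-x\|^2\}$. For $\alpha>0$, $$\mathcal{R}_n(\alpha):=\sup\frac{\|x_n-z_n\|}{\|x_0-x_*\|},$$ where the supremum is over all dimensions $d\ge1$ and all triples $(F,x_0,x_* )$ with $F:\mathbb{R}^d\to\mathbb{R}\cup\{+\infty\}$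 proper, closed, and convex, $x_*\in\arg\min F$, and $x_0\neq x_*$, and the iterates are $z_k=\operatorname{prox}_{\lambda F}(x_k)$ for $0\le k\le n$ and $x_{k+1}=x_k+\alpha(z_k-x_k)$ for $0\le k<n$. The suprema are taken in $[0,+\infty]$. *)

(* Defs.v *)
From HB Require Import structures.
From mathcomp Require Import all_boot all_order all_algebra.
From mathcomp Require Import all_classical all_reals all_analysis.
From mathcomp Require Import ring lra.

Set Implicit Arguments.
Unset Strict Implicit.
Unset Printing Implicit Defensive.

Import Order.TTheory GRing.Theory Num.Theory.
Import numFieldNormedType.Exports.

Local Open Scope classical_set_scope.
Local Open Scope ring_scope.

Definition argmin {disp : Order.disp_t} {T : Type} {U : porderType disp}
    (D : set T) (f : T -> U) : set T :=
  [set x | D x /\ forall y, D y -> (f x <= f y)%O].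

Section Constants.
Variable R : realType.

Definition r_eqn (n : nat) : set R :=
  [set r | 0 < r < 1 /\ r ^+ n * (1 + n%:R * (1 + r)) = 1].

(* The default value 0 is irrelevant for n >= 1: see r_cstP and r_cst_unique. *)
Definition r_cst (n : nat) : R := xget 0 (r_eqn n).
Definition h_cst (n : nat) : R := 1 + r_cst n.
Definition eta_cst (n : nat) : R := r_cst n ^+ n.

Lemma r_cst_unique n r s : (0 < n)%N -> r_eqn n r -> r_eqn n s -> r = s.
Proof.
move=> n0.
have lt_absurd x y : r_eqn n x -> r_eqn n y -> ~ x < y.
  move=> [/andP[x0 x1] ex] [/andP[y0 y1] ey] xy.
  have : x ^+ n * (1 + n%:R * (1 + x)) < y ^+ n * (1 + n%:R * (1 + y)).
    apply: ltr_pM.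
    - by rewrite exprn_ge0// ltW.
    - by rewrite addr_ge0// mulr_ge0// addr_ge0// ltW.
    - by rewrite ltrXn2r -?lt0n// ltW.
    - by rewrite ltrD2l ltr_pM2l ?ltr0n// ltrD2l.
  by rewrite ex ey ltxx.
move=> hr hs; have [rs|sr|//] := ltgtP r s.
- by case: (lt_absurd _ _ hr hs).
- by case: (lt_absurd _ _ hs hr).
Qed.

Lemma r_cstP n : (0 < n)%N -> r_eqn n (r_cst n).
Proof.
move=> n0; rewrite /r_cst; case: xgetP => [r -> //|noroot].
pose p : {poly R} := 'X^n * (1 + n%:R%:P * (1 + 'X)) - 1.
have pE x : p.[x] = x ^+ n * (1 + n%:R * (1 + x)) - 1 by rewrite /p !hornerE.
have n1 : 1 <= n%:R :> R by rewrite ler1n.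
have p0 : p.[0] <= 0 by rewrite pE expr0n eqn0Ngt n0/= mul0r sub0r oppr_le0.
have p1 : 0 <= p.[1] by rewrite pE expr1n mul1r; lra.
have /poly_ivt : p.[0] <= 0 <= p.[1] by rewrite p0 p1.
move=> /(_ ler01)[x /andP[x0 x1]]; rewrite rootE pE => /eqP px.
case: (noroot x); split; last by apply/eqP; rewrite -subr_eq0 px.
apply/andP; split; rewrite lt_neqAle ?x0 ?x1 andbT; apply/eqP => xE; move: px.
- by rewrite -xE expr0n eqn0Ngt n0/= mul0r sub0r => /eqP; rewrite oppr_eq0 oner_eq0.
- by rewrite xE expr1n mul1r; lra.
Qed.

Lemma eta_cstE n : (0 < n)%N -> eta_cst n = 1 / (1 + n%:R * h_cst n).
Proof.
move=> n0; have [/andP[r0 r1] rE] := r_cstP n0.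
rewrite /eta_cst /h_cst -[X in X / _]rE mulfK// gt_eqF// ltr_pwDl//.
by rewrite mulr_ge0// addr_ge0// ltW.
Qed.

End Constants.

(* The library norm `|x| on 'rV is the sup norm; it is used below only through
   the topology it induces (differentiability, lower semicontinuity), which is
   the Euclidean one. *)
Definition enorm {R : realType} {d : nat} (x : 'rV[R]_d) : R :=
  Num.sqrt (\sum_(i < d) x 0 i ^+ 2).

Section Smooth.
Variables (R : realType) (d : nat).
Implicit Types (f : 'rV[R]_d.+1 -> R) (x : 'rV[R]_d.+1).

Definition grad f x : 'rV[R]_d.+1 := \row_(i < d.+1) 'D_(delta_mx 0 i) f x.

Definition smooth (L : R) f : Prop :=
  (forall x, differentiable f x) /\
  (forall x y, enorm (grad f x - grad f y) <= L * enorm (x - y)).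

Definition gd (L alpha : R) f x0 (k : nat) : 'rV[R]_d.+1 :=
  iter k (fun x => x - (alpha / L) *: grad f x) x0.

End Smooth.

(* The dimension of the space is d.+1, so d : nat covers all dimensions >= 1. *)
Definition Gcrit {R : realType} (L : R) (n : nat) (alpha : R) : \bar R :=
  ereal_sup [set q | exists (d : nat) (f : 'rV[R]_d.+1 -> R)
                            (x0 xs : 'rV[R]_d.+1),
    [/\ convex_function setT f, smooth L f, argmin setT f xs, x0 != xs &
        q = (enorm (grad f (gd L alpha f x0 n)) / (L * enorm (x0 - xs)))%:E]].

Section Proximal.
Variables (R : realType) (d : nat).
Implicit Types (F : 'rV[R]_d.+1 -> \bar R) (x : 'rV[R]_d.+1).

Definition proper F : Prop :=
  (forall x, F x != -oo%E) /\ (exists x, F x != +oo%E).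

(* Meant for F > -oo; the library convention 0 * +oo = 0 makes the cases
   t = 0 and t = 1 trivial. *)
Definition econvex F : Prop :=
  forall x y (t : R), 0 <= t <= 1 ->
    (F (t *: x + (1 - t) *: y)%R <= t%:E * F x + (1 - t)%:E * F y)%E.

(* If lambda > 0 and F is proper, closed and convex, the argmin is a singleton;
   otherwise xget picks a minimizer, or returns x if there is none. *)
Definition prox (lambda : R) F x : 'rV[R]_d.+1 :=
  xget x (argmin setT
    (fun z => (F z + ((2 * lambda)^-1 * enorm (z - x) ^+ 2)%R%:E)%E)).

Definition rppa (lambda alpha : R) F x0 (k : nat) : 'rV[R]_d.+1 :=
  iter k (fun x => x + alpha *: (prox lambda F x - x)) x0.

End Proximal.

Definition Rcrit {R : realType} (lambda : R) (n : nat) (alpha : R) : \bar R :=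
  ereal_sup [set q | exists (d : nat) (F : 'rV[R]_d.+1 -> \bar R)
                            (x0 xs : 'rV[R]_d.+1),
    [/\ [/\ proper F, lower_semicontinuous F & econvex F],
        argmin setT F xs, x0 != xs &
        let xn := rppa lambda alpha F x0 n in
        q = (enorm (xn - prox lambda F xn) / enorm (x0 - xs))%:E]].

(* Main.v *)
Require Import Defs.
From mathcomp Require Import all_boot all_order all_algebra.
From mathcomp Require Import finmap.
From mathcomp Require Import all_classical all_reals all_analysis.
From mathcomp Require Import ring lra zify.

Set Implicit Arguments.
Unset Strict Implicit.
Unset Printing Implicit Defensive.

Import Order.TTheory GRing.Theory Num.Theory.
Import numFieldNormedType.Exports.

Local Open Scope classical_set_scope.
Local Open Scope ring_scope.

(* Upper bound. Let g_k be the scaled gradient (grad f x_k) / L, respectively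
   the residual x_k - prox x_k, and z_k = x_k - g_k - x_*. With the step 1 + r
   both methods satisfy z_k - z_(k+1) = r g_k + g_(k+1), and there are numbers
   F_k >= 0 with <g_j, z_i - z_j> <= F_i - F_j and F_j <= <g_j, z_j>: the
   interpolation inequalities of smooth convex functions, respectively the
   subgradient inequalities at the proximal points. These relations alone imply
   |g_n| <= r^n |z_0 + g_0|, by two bounds that meet halfway: for n = 2 m,
     2 F_m + |g_m|^2 <= r^n |z_0 + g_0|^2,  |g_n|^2 <= r^n (2 F_m + |g_m|^2).
   For odd n the midpoint falls between two indices and the quantity in the
   middle is a mixture over both of them; n = 1 is treated apart.
   Lower bound. In dimension one the quadratic (resp. the indicator of the
   origin) forces |1 - alpha|^n, and a Huber function (resp. a multiple of the
   positive part) forces 1 / (1 + n alpha). These two bounds cross exactly at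
   alpha = 1 + r, where they equal r^n. *)

(** * Inequalities for the root [r] *)

Section Numeric.
Variable R : realFieldType.
Implicit Types (r : R) (n m p k j : nat).

(** Each half is an induction whose step adds a few of the available inequalities with explicit
    multipliers, chosen so that the terms without a sign cancel. Once the multipliers are known, a
    step is a polynomial identity; the obstacle is that they must be nonnegative for every index.
    Most of these signs amount to comparing a power of [r] with a product or quotient of affine
    functions of the index. The equation of [r] makes such a comparison exact at one end of the
    index range, sometimes at both, and log-concavity carries it to the indices between. The
    remaining signs come from convexity of the sequence [mass] and from Bernoulli's inequality. The
    multipliers have denominators [p - k] and [n - k], which vanish at the end of the respective
    half; this is why the last step of each half is carried out separately. For odd [n] the end that
    is not exact requires numerical bounds on [r], which come from a truncated binomial expansion of
    the equation of [r]. *)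

Lemma quasiconcave_ge (c : R) (x : nat -> R) (N : nat) :
  (forall j, (j.+2 <= N)%N -> x j.+1 <= x j -> x j.+2 <= x j.+1) ->
  c <= x 0%N -> c <= x N -> forall j, (j <= N)%N -> c <= x j.
Proof.
move=> hx h0 hN; elim=> [//|j IH] ltjN.
have [lexj|/ltW lexj] := leP (x j) (x j.+1).
  exact: le_trans (IH (ltnW ltjN)) lexj.
apply: le_trans hN _.
have H i : (j + i.+1 <= N)%N -> x (j + i.+1)%N <= x (j + i)%N.
  elim: i => [|i IHi] hi; first by rewrite addn1 addn0.
  rewrite !addnS in hi *; apply: hx => //.
  by move: IHi; rewrite addnS; apply; exact: ltnW.
have H' i : (j + i.+1 <= N)%N -> x (j + i.+1)%N <= x j.+1.
  elim: i => [|i IHi] hi; first by rewrite addn1.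
  rewrite addnS in hi; apply: le_trans (IHi (ltnW hi)).
  by apply: H; rewrite addnS.
by move: (H' (N - j.+1)%N); rewrite addnS -addSn subnKC//; apply.
Qed.

(** A geometric factor preserves log-concavity, and a positive log-concave sequence is unimodal, so
    its minimum over an interval of indices is at an end. This reduces the three transport
    inequalities below to their end values. *)
Lemma logconcave_ge (b c : R) (P : nat -> R) (N : nat) : 0 < b ->
  (forall j, (j <= N)%N -> 0 < P j) ->
  (forall j, (j.+2 <= N)%N -> P j * P j.+2 <= P j.+1 ^+ 2) ->
  c <= P 0%N -> c <= b ^+ N * P N ->
  forall j, (j <= N)%N -> c <= b ^+ j * P j.
Proof.
move=> b0 P0 lc c0 cN; apply: quasiconcave_ge; rewrite ?expr0 ?mul1r//.
move=> j jN; have bj := exprn_gt0 j b0.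
have P1 : 0 < P j.+1 by apply: P0; exact: ltnW.
have P2 : 0 < P j.+2 by exact: P0.
rewrite !exprSr -!mulrA !ler_pM2l// => le1.
rewrite -(ler_pM2r P1) -expr2; apply: le_trans (lc _ jN).
by rewrite mulrAC ler_pM2r.
Qed.

(* Subadditivity of tanh: with r = exp (- 2 x) this is tanh (n x) <= n tanh x. *)
Lemma tanh_subadditive r n : 0 <= r <= 1 ->
  (1 + r) * (1 - r ^+ n) <= n%:R * (1 - r) * (1 + r ^+ n).
Proof.
move=> /andP[r0 r1].
(* [1 - r] times this quantity is the increment in [n] of the right side minus the left side. *)
have H k : 0 <= 1 + k%:R * r ^+ k.+1 - k.+1%:R * r ^+ k.
  elim: k => [|k IH]; first by rewrite expr0; lra.
  have rk : 0 <= r ^+ k by apply: exprn_ge0.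
  have k0 : 0 <= k%:R :> R by [].
  have rk1 : r ^+ k <= 1 by apply: exprn_ile1.
  have : 0 <= r * (1 + k%:R * r ^+ k.+1 - k.+1%:R * r ^+ k) by apply: mulr_ge0.
  have : 0 <= (1 - r) * (1 - r * r ^+ k) by apply: mulr_ge0; rewrite subr_ge0 ?mulr_ile1.
  rewrite !exprS -!natr1; lra.
elim: n => [|n IH]; first by rewrite expr0; lra.
have := H n; rewrite !exprS -!natr1 => Hn.
have : 0 <= (1 - r) * (1 + n%:R * (r * r ^+ n) - (n%:R + 1) * r ^+ n) by apply: mulr_ge0; lra.
by lra.
Qed.

(** By the equation of [r], [1 - r^n = n (1 + r) r^n] and [1 + r^n = (2 + n (1 + r)) r^n].
    Substituted in [tanh_subadditive], the powers [r^n] disappear and a factor [n] cancels. *)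
Lemma root_quadratic_bound r n : (0 < n)%N -> 0 < r < 1 -> r ^+ n * (1 + n%:R * (1 + r)) = 1 ->
  r ^+ 2 + 4 * r - 1 <= n%:R * (1 - r ^+ 2).
Proof.
move=> n0 /andP[r0 r1] rn.
have nn : 0 < n%:R :> R by rewrite ltr0n.
have /tanh_subadditive : 0 <= r <= 1 by rewrite !ltW.
move/(_ n) => T.
have P : 0 < 1 + n%:R * (1 + r) by nra.
move: T; rewrite -(ler_pM2r P) => T.
have {T} : (1 + r) * (n%:R * (1 + r)) <= n%:R * (1 - r) * (2 + n%:R * (1 + r)).
  have -> : (1 + r) * (n%:R * (1 + r)) = (1 + r) * (1 - r ^+ n) * (1 + n%:R * (1 + r)).
    by rewrite -mulrA mulrBl rn; ring.
  have -> : n%:R * (1 - r) * (2 + n%:R * (1 + r)) = n%:R * (1 - r) * (1 + r ^+ n) * (1 + n%:R * (1 + r)).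
    by rewrite -[RHS]mulrA mulrDl rn; ring.
  exact: T.
by rewrite mulrCA -mulrA ler_pM2l//; nra.
Qed.

(** Both ends are equalities: [j = 0] trivially, [j = m] by the equation of [r]. The product of the
    two affine factors is log-concave. With [j = m - k] this becomes the sign of [direct k] for
    [n = 2 m]. *)
Lemma even_transport_pos r m : 0 < r < 1 -> r ^+ (2 * m) * (1 + (2 * m)%:R * (1 + r)) = 1 ->
  forall j, (j <= m)%N -> 1 + m%:R * (1 + r) <=
    (r ^+ 2) ^+ j * ((1 + (m + j)%:R * (1 + r)) * (1 + j%:R * (1 + r))).
Proof.
move=> /andP[r0 r1] rm; apply: logconcave_ge; first exact: exprn_gt0.
- by move=> j _; apply: mulr_gt0; rewrite ltr_pwDl// mulr_ge0//; lra.
- move=> j _; rewrite !addnS -!natr1.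
  set A := (m + j)%:R; set B := j%:R.
  have A0 : 0 <= A by []. have B0 : 0 <= B by [].
  set a := 1 + (A + 1) * (1 + r); set b := 1 + (B + 1) * (1 + r).
  have a0 : 1 + r <= a by rewrite /a; nra.
  have b0 : 1 + r <= b by rewrite /b; nra.
  have -> : 1 + A * (1 + r) = a - (1 + r) by rewrite /a; ring.
  have -> : 1 + B * (1 + r) = b - (1 + r) by rewrite /b; ring.
  have -> : 1 + (A + 1 + 1) * (1 + r) = a + (1 + r) by rewrite /a; ring.
  have -> : 1 + (B + 1 + 1) * (1 + r) = b + (1 + r) by rewrite /b; ring.
  have -> : (a - (1 + r)) * (b - (1 + r)) * ((a + (1 + r)) * (b + (1 + r)))
    = (a ^+ 2 - (1 + r) ^+ 2) * (b ^+ 2 - (1 + r) ^+ 2) by ring.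
  rewrite exprMn; apply: ler_pM; rewrite ?subr_ge0 ?gerBl ?sqr_ge0// lerXn2r ?nnegrE//; lra.
- by rewrite addn0 mul0r addr0 mulr1.
- by rewrite -exprM mulrA addnn -mul2n rm mul1r.
Qed.

(** The index [m + s + j] runs through the second half; [s] is used as the parity of [n]. The
    quotient in [P] is log-concave because its decreasing numerator stays below its increasing
    denominator. The end [j = m] is the equation of [r], and the end [j = 0] is the last
    hypothesis. *)
Lemma second_transport_le r (s m : nat) : 0 < r < 1 ->
  let n := (2 * m + s)%N in
  r ^+ n * (1 + n%:R * (1 + r)) = 1 ->
  1 + (m + s)%:R * (1 + r) <= r ^- s * (1 + m%:R * (1 + r)) ->
  forall j, (j <= m)%N ->
    1 + (m + s + j)%:R * (1 + r) <= r ^- (2 * j + s) * (1 + (m - j)%:R * (1 + r)).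
Proof.
move=> /andP[r0 r1] n rn base.
pose P (j : nat) := r ^- s * ((1 + (m%:R - j%:R) * (1 + r)) / (1 + (m + s + j)%:R * (1 + r))).
have d0 j : 0 < 1 + (m + s + j)%:R * (1 + r) by rewrite ltr_pwDl// mulr_ge0//; lra.
have c0 j : (j <= m)%N -> 0 < 1 + (m%:R - j%:R) * (1 + r).
  by move=> jm; rewrite ltr_pwDl// mulr_ge0// ?subr_ge0 ?ler_nat//; lra.
have rs : 0 < r ^- s by rewrite invr_gt0 exprn_gt0.
have r2 : 0 < r ^- 2 by rewrite invr_gt0 exprn_gt0.
suff H : forall j, (j <= m)%N -> 1 <= (r ^- 2) ^+ j * P j.
  move=> j jm; have := H _ jm; rewrite /P !mulrA ler_pdivlMr// mul1r natrB// => /le_trans; apply.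
  by rewrite -exprVn -exprM -!exprVn -exprD.
apply: logconcave_ge => //.
- by move=> j jm; rewrite /P mulr_gt0// divr_gt0// c0.
- move=> j jm; rewrite /P.
  have := d0 j; have := d0 j.+1; have := d0 j.+2; have := c0 _ jm.
  rewrite !addnS -!natr1.
  set A := _ - _; set B := (m + s + j)%:R => A0 B2 B1 B0.
  have BA : A + 1 <= B.
    rewrite /A /B !natrD; have : 0 <= s%:R :> R by []. have : 0 <= j%:R :> R by []. lra.
  rewrite mulrACA exprMn -expr2 ler_pM2l ?exprn_gt0// expr_div_n mulf_div.
  rewrite ler_pdivrMr ?mulr_gt0// mulrAC ler_pdivlMr ?exprn_gt0//.
  have -> : 1 + (m%:R - j%:R) * (1 + r) = 1 + (A + 1) * (1 + r) + (1 + r) by rewrite /A; ring.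
  have -> : 1 + (m%:R - (j%:R + 1)) * (1 + r) = 1 + (A + 1) * (1 + r) by rewrite /A; ring.
  have -> : 1 + A * (1 + r) = 1 + (A + 1) * (1 + r) - (1 + r) by ring.
  have -> : 1 + B * (1 + r) = 1 + (B + 1) * (1 + r) - (1 + r) by ring.
  have -> : 1 + (B + 1 + 1) * (1 + r) = 1 + (B + 1) * (1 + r) + (1 + r) by ring.
  set a := 1 + (A + 1) * (1 + r); set b := 1 + (B + 1) * (1 + r).
  have ab : a ^+ 2 <= b ^+ 2.
    rewrite lerXn2r ?nnegrE ?/a ?/b; nra.
  have -> : (a + (1 + r)) * (a - (1 + r)) * b ^+ 2 = a ^+ 2 * b ^+ 2 - (1 + r) ^+ 2 * b ^+ 2 by ring.
  have -> : a ^+ 2 * ((b - (1 + r)) * (b + (1 + r))) = a ^+ 2 * b ^+ 2 - (1 + r) ^+ 2 * a ^+ 2 by ring.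
  by rewrite lerB// ler_wpM2l// sqr_ge0.
- by rewrite /P subr0 mulrA ler_pdivlMr// mul1r addn0.
- rewrite /P subrr mul0r addr0 mul1r mulrA ler_pdivlMr// mul1r.
  rewrite -exprVn -exprM -exprVn -exprD -/n.
  have -> : (m + s + m = n)%N by rewrite /n; lia.
  rewrite exprVn -[leRHS]mul1r ler_pdivlMr ?exprn_gt0// mulrC; lra.
Qed.

Lemma exprD1n_cubic_ge (a : R) n : 0 <= a ->
  1 + n%:R * a + n%:R * (n%:R - 1) / 2 * a ^+ 2
    + n%:R * (n%:R - 1) * (n%:R - 2) / 6 * a ^+ 3 <= (1 + a) ^+ n.
Proof.
move=> a0; elim: n => [|n IH]; first by rewrite expr0; lra.
have : 0 <= (a ^+ 4) * (n%:R * (n%:R - 1) * (n%:R - 2)).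
  apply: mulr_ge0; first exact: exprn_ge0.
  case: n {IH} => [|[|n]]; [by rewrite !mul0r | by rewrite subrr mulr0 mul0r |].
  have := ler0n R n; rewrite -[n.+2%:R]natr1 -[n.+1%:R]natr1 => n0.
  by apply: mulr_ge0; [apply: mulr_ge0|]; lra.
have : 0 <= (1 + a) * ((1 + a) ^+ n - (1 + n%:R * a + n%:R * (n%:R - 1) / 2 * a ^+ 2
    + n%:R * (n%:R - 1) * (n%:R - 2) / 6 * a ^+ 3)).
  by apply: mulr_ge0; rewrite ?subr_ge0// addr_ge0.
by rewrite [(1 + a) ^+ n.+1]exprS -[n.+1%:R]natr1; lra.
Qed.

(** With [a = 1 / r - 1] and [n = 2 p + 1] the equation of [r] is [(1 + a)^n = 1 + n (1 + r)].
    Truncating the expansion and dividing by [n] gives [p a^2 + p (2 p - 1) / 3 a^3 <= 1 + r - a].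
    The first claim keeps only the quadratic term, the second needs the cubic one too. The value
    63/100 lies just below the root for [n = 5]. *)
Lemma root_odd_bounds r p : 0 < r < 1 ->
  r ^+ (2 * p + 1) * (1 + (2 * p + 1)%:R * (1 + r)) = 1 -> (0 < p)%N ->
  p%:R * (1 - r) ^+ 2 <= r * (r ^+ 2 + 2 * r - 1) /\ ((2 <= p)%N -> 63 / 100 <= r).
Proof.
move=> /andP[r0 r1] rn p0.
pose a := (1 - r) / r.
have a0 : 0 < a by rewrite divr_gt0// subr_gt0.
have ar : a * r = 1 - r by rewrite /a divfK// gt_eqF.
have := @exprD1n_cubic_ge a (2 * p + 1) (ltW a0).
have -> : 1 + a = r^-1 by rewrite /a; field; rewrite gt_eqF.
have -> : r^-1 ^+ (2 * p + 1) = 1 + (2 * p + 1)%:R * (1 + r).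
  have rp : r ^+ (2 * p + 1) != 0 by rewrite expf_neq0// gt_eqF.
  by rewrite exprVn; apply: (mulfI rp); rewrite mulfV.
rewrite natrD natrM.
have : 1 <= p%:R :> R by rewrite ler1n.
set P := p%:R => P1 H.
have {}H : P * a ^+ 2 + P * (2 * P - 1) / 3 * a ^+ 3 <= 1 + r - a.
  rewrite -(ler_pM2l (_ : 0 < 2 * P + 1)); lra.
have H2 : P * a ^+ 2 <= 1 + r - a.
  apply: le_trans H; rewrite lerDl.
  by apply: mulr_ge0; [apply: divr_ge0 => //; nra | apply: exprn_ge0; exact: ltW].
split.
  have : P * (a * r) ^+ 2 <= (1 + r) * r ^+ 2 - (a * r) * r.
    have -> : (1 + r) * r ^+ 2 - (a * r) * r = (1 + r - a) * r ^+ 2 by ring.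
    by rewrite exprMn mulrA ler_pM2r// exprn_gt0.
  rewrite ar; lra.
move=> p2; have P2 : 2 <= P by rewrite /P ler_nat.
have {}H : 2 * a ^+ 2 + 2 * a ^+ 3 <= 1 + r - a.
  have ? : 2 <= P * (2 * P - 1) / 3 by nra.
  apply: le_trans H; apply: lerD; (apply: ler_wpM2r => //; apply: exprn_ge0; exact: ltW).
have {}H : 2 * (1 - r) ^+ 2 * r + 2 * (1 - r) ^+ 3 <= (1 + r) * r ^+ 3 - (1 - r) * r ^+ 2.
  have -> : 2 * (1 - r) ^+ 2 * r + 2 * (1 - r) ^+ 3 = (2 * a ^+ 2 + 2 * a ^+ 3) * r ^+ 3.
    by rewrite -ar; ring.
  have -> : (1 + r) * r ^+ 3 - (1 - r) * r ^+ 2 = (1 + r - a) * r ^+ 3 by rewrite -ar; ring.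
  by rewrite ler_pM2r// exprn_gt0.
rewrite leNgt; apply/negP => lt; nra.
Qed.
End Numeric.

Section FirstPart.
Variables (R : realFieldType) (r : R) (n p : nat).

(** At [j = 0] the inequality would be the reverse of [mass p <= p], so log-concavity has to start
    from [j = 1]. This end is no longer an identity and relies on [root_odd_bounds], except for
    [p = 1], where it coincides with the end [j = p]. *)
Lemma odd_transport_pos : 0 < r < 1 ->
  r ^+ (2 * p + 1) * (1 + (2 * p + 1)%:R * (1 + r)) = 1 ->
  forall j, (0 < j <= p)%N -> 1 + p%:R * (1 + r) <=
    r ^+ (2 * j + 1) * ((1 + (p + 1 + j)%:R * (1 + r)) * (1 + j%:R * (1 + r))).
Proof.
move=> /andP[r0 r1] rp [//|j] /= jp.
have p0 : (0 < p)%N by exact: leq_ltn_trans jp.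
have [B1 B2] : p%:R * (1 - r) ^+ 2 <= r * (r ^+ 2 + 2 * r - 1) /\
    ((2 <= p)%N -> 63 / 100 <= r) by apply: root_odd_bounds; rewrite ?r0.
have h0 : 0 < 1 + r by lra.
have pR : 0 <= p%:R :> R by [].
pose P (i : nat) := r ^+ 3 * ((1 + (p%:R + 2 + i%:R) * (1 + r)) * (1 + (1 + i%:R) * (1 + r))).
suff H : forall i, (i <= p.-1)%N -> 1 + p%:R * (1 + r) <= (r ^+ 2) ^+ i * P i.
  have /H : (j <= p.-1)%N by lia.
  rewrite /P mulrA -exprM -exprD.
  have -> : (2 * j + 3 = 2 * j.+1 + 1)%N by lia.
  by rewrite !natrD -natr1; congr (_ <= _ * (_ * _)); ring.
have Pend : 1 + p%:R * (1 + r) <= (r ^+ 2) ^+ p.-1 * P p.-1.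
  rewrite /P mulrA -exprM -exprD.
  have -> : (2 * p.-1 + 3 = 2 * p + 1)%N by lia.
  have -> : p.-1%:R = p%:R - 1 :> R by rewrite -[in RHS](prednK p0) -natr1 addrK.
  rewrite mulrA; move: rp; rewrite natrD natrM => rp.
  have -> : 1 + (p%:R + 2 + (p%:R - 1)) * (1 + r) = 1 + (2 * p%:R + 1) * (1 + r) by ring.
  rewrite rp; lra.
apply: logconcave_ge => //; first exact: exprn_gt0.
- have Q0 (x : R) : 0 <= x -> 0 < 1 + x * (1 + r) by move=> x0; rewrite ltr_pwDl// mulr_ge0// ltW.
  by move=> i _; rewrite mulr_gt0 ?exprn_gt0// mulr_gt0// Q0// !addr_ge0.
- move=> i _; rewrite /P mulrACA exprMn -expr2; apply: ler_wpM2l; first by rewrite !exprn_ge0// ltW.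
  rewrite -[i.+2%:R]natr1 -[i.+1%:R]natr1; have : 0 <= i%:R :> R by [].
  move: (i%:R) => x x0.
  set a := 1 + (p%:R + 2 + (x + 1)) * (1 + r); set b := 1 + (1 + (x + 1)) * (1 + r).
  have a0 : 1 + r <= a by rewrite /a; nra.
  have b0 : 1 + r <= b by rewrite /b; nra.
  have -> : 1 + (p%:R + 2 + x) * (1 + r) = a - (1 + r) by rewrite /a; ring.
  have -> : 1 + (1 + x) * (1 + r) = b - (1 + r) by rewrite /b; ring.
  have -> : 1 + (p%:R + 2 + (x + 1 + 1)) * (1 + r) = a + (1 + r) by rewrite /a; ring.
  have -> : 1 + (1 + (x + 1 + 1)) * (1 + r) = b + (1 + r) by rewrite /b; ring.
  have -> : (a - (1 + r)) * (b - (1 + r)) * ((a + (1 + r)) * (b + (1 + r)))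
    = (a ^+ 2 - (1 + r) ^+ 2) * (b ^+ 2 - (1 + r) ^+ 2) by ring.
  rewrite exprMn; apply: ler_pM; rewrite ?subr_ge0 ?gerBl ?sqr_ge0// lerXn2r ?nnegrE//; lra.
- case: (ltnP 1 p) => p1; last first.
    have p1' : p = 1%N by apply/eqP; rewrite eqn_leq p1.
    by move: Pend; rewrite p1' /= expr0 mul1r.
  have r63 := B2 p1; rewrite /P !addr0 mul1r.
  have : 2 <= p%:R :> R by rewrite ler_nat.
  move: (p%:R) B1 => x B1 x2.
  (* The difference of the two sides is affine in [p], and the coefficient of [p] has the sign of
     [r^3 (2 + r) - 1]. When it is negative, the upper bound [B1] on [p] is inserted, which leaves
     the inequality [PI] in [r] alone. *)
  have [|lt1] := leP 1 (r ^+ 3 * (2 + r)).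
    move=> le1.
    have : 0 <= (r ^+ 3 * (2 + r) - 1) * (1 + (x + 2) * (1 + r)) by apply: mulr_ge0; nra.
    nra.
  have Q : 0 <= (1 - r ^+ 3 * (2 + r)) * (1 + r) * (r * (r ^+ 2 + 2 * r - 1) - x * (1 - r) ^+ 2).
    by apply: mulr_ge0; [apply: mulr_ge0; lra | rewrite subr_ge0].
  have r1' : 0 < (1 - r) ^+ 2 by rewrite exprn_gt0// subr_gt0.
  rewrite -subr_ge0 -(pmulr_rge0 _ r1').
  have PI : r * (r ^+ 2 + 2 * r - 1) * (1 + r) * (1 - r ^+ 3 * (2 + r)) <=
     (1 - r) ^+ 2 * (r ^+ 3 * (2 + r) * (3 + 2 * r) - 1).
    (* Expanded at 63/100, the difference of the two sides has nonnegative coefficients. *)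
    have [t t0 ->] : exists2 t, 0 <= t & r = 63 / 100 + t.
      by exists (r - 63 / 100); lra.
    have T k : 0 <= t ^+ k by apply: exprn_ge0.
    have := (T 2, T 3, T 4, T 5, T 6, T 7, T 8).
    move=> [[[[[[]]]]]]; lra.
  lra.
Qed.
End FirstPart.

(** * Scalar induction for the first half *)

Lemma first_step_alg (R : realFieldType) (r v q b a w s0 g tp t t' z z' zp f e X0 : R) :
  - (r ^+ 2 * w - a) * (tp - t) + (r ^+ 2 * w * v - a * (v + 1)) * z - g * zp <=
    s0 * (X0 - tp) - r ^+ 2 * w * e ->
  0 <= (r * w - q * b) * (t' + (v - 1) * z' - (t + v * z) + 2 * (1 + r) * f - (z - z')) ->
  0 <= b * (tp + (v - q) * zp - (t + v * z) + 2 * (1 + r) * q * f - q * (z - zp)) ->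
  0 <= - (r * w - q * b + b - a + r ^+ 2 * w - w) * (tp - t) ->
  (r * w - q * b + b - a + r ^+ 2 * w - w) * v * z = (a - r * w) * z ->
  - (w - (r * w - q * b)) * (tp - t') + (w * (v - 1) - (r * w - q * b) * v) * z' - (g + b * v) * zp <=
  s0 * (X0 - tp) - w * (r ^+ 2 * e + (t + v * z) - (t' + (v - 1) * z') - 2 * r * (1 + r) * f).
Proof.
move=> H1 H2 H3 H4 H5.
rewrite -subr_ge0 in H1; have := addr_ge0 (addr_ge0 H1 H2) (addr_ge0 H3 H4).
move=> H; rewrite -subr_ge0.
apply: le_trans H _; rewrite le_eqVlt; apply/orP; left; apply/eqP.
rewrite -[LHS]addr0 -[X in _ + X](subrr ((a - r * w) * z)) -[X in _ + (X - _)]H5; ring.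
Qed.

Section FirstPart.
Variables (R : realFieldType) (r : R) (n p : nat).
Hypothesis r01 : 0 < r < 1.
Hypothesis rn : r ^+ n * (1 + n%:R * (1 + r)) = 1.
Hypothesis pn : (2 * p <= n)%N.
Hypothesis p_gt0 : (0 < p)%N.

(* In the proof of first_part_invariant the inequality energy_jump is used
   between k and k.+1 with multiplier direct_rate k.+1, and between k and the
   midpoint p with multiplier (bypass k.+1 - bypass k) / (n - k). *)
Definition weight k : R := r ^+ (n - 2 * k).
Definition mass k : R := (weight k * (1 + (n%:R - k%:R) * (1 + r)) - 1) / (1 + r).
Definition bypass k : R := (k%:R - mass k) / ((1 + r) * (p%:R - k%:R)).
Definition direct k : R := mass k - bypass k.
Definition direct_rate k : R := direct k / (n%:R - k%:R + 1).

Hypothesis spread : 1 <= (n%:R - p%:R) * (1 - r) + 2 * (1 - r).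
Hypothesis mass_end : mass p <= p%:R.
Hypothesis direct_pos : forall k, (0 < k < p)%N -> 0 <= direct k.

Let r0 : 0 < r. Proof. by case/andP: r01. Qed.
Let r1 : r < 1. Proof. by case/andP: r01. Qed.
Let h0 : 0 < 1 + r. Proof. by rewrite addr_gt0. Qed.

Let weight_gt0 k : 0 < weight k. Proof. exact: exprn_gt0. Qed.

Let weightS k : (k < p)%N -> weight k = r ^+ 2 * weight k.+1.
Proof. by move=> kp; rewrite /weight -exprD; congr (r ^+ _); lia. Qed.

Let mass0 : mass 0 = 0.
Proof. by rewrite /mass /weight muln0 subn0 subr0 rn subrr mul0r. Qed.

Let massE k : mass k * (1 + r) = weight k * (1 + (n%:R - k%:R) * (1 + r)) - 1.
Proof. by rewrite /mass divfK// gt_eqF. Qed.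

Let lt_kn k : (k < p)%N -> k%:R + 1 <= p%:R :> R.
Proof. by move=> kp; rewrite natr1 ler_nat. Qed.

Let pnR : 2 * p%:R <= n%:R :> R.
Proof. by rewrite -natrM ler_nat. Qed.

Let p1R : 1 <= p%:R :> R.
Proof. by rewrite ler1n. Qed.

(** The second difference is a positive multiple of [(n - k) (1 - r) - 1]; the hypothesis [spread]
    is its nonnegativity at the last index, [k = p - 2]. *)
Let mass_convex k : (k.+2 <= p)%N -> 2 * mass k.+1 <= mass k + mass k.+2.
Proof.
move=> kp; rewrite -(ler_pM2r h0) -mulrA [leRHS]mulrDl !massE.
rewrite (weightS (ltnW kp)) (weightS kp).
have kp2 : k%:R + 2 <= p%:R :> R by rewrite -natrD ler_nat addn2.
have -> : k.+2%:R = k%:R + 2 :> R by rewrite -natrD addn2.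
have -> : k.+1%:R = k%:R + 1 :> R by rewrite natr1.
have N2 := pnR; have N1 := p1R.
set v := n%:R - k%:R.
have V : 1 <= v * (1 - r).
  apply: le_trans spread _; rewrite -mulrDl ler_pM2r ?subr_gt0// /v; lra.
have -> : n%:R - (k%:R + 1) = v - 1 by rewrite /v; ring.
have -> : n%:R - (k%:R + 2) = v - 2 by rewrite /v; ring.
have -> : 2 * (r ^+ 2 * weight k.+2 * (1 + (v - 1) * (1 + r)) - 1)
  = weight k.+2 * (2 * r ^+ 2 * (1 + (v - 1) * (1 + r))) - 2 by ring.
have -> : r ^+ 2 * (r ^+ 2 * weight k.+2) * (1 + v * (1 + r)) - 1 + (weight k.+2 * (1 + (v - 2) * (1 + r)) - 1)
  = weight k.+2 * (r ^+ 4 * (1 + v * (1 + r)) + (1 + (v - 2) * (1 + r))) - 2 by ring.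
rewrite lerD2r ler_pM2l// -subr_ge0.
have -> : r ^+ 4 * (1 + v * (1 + r)) + (1 + (v - 2) * (1 + r)) - 2 * r ^+ 2 * (1 + (v - 1) * (1 + r))
  = (1 - r ^+ 2) * (1 + r) ^+ 2 * (v * (1 - r) - 1) by ring.
apply: mulr_ge0; [apply: mulr_ge0; [|exact: sqr_ge0]|lra].
by rewrite subr_ge0 exprn_ile1// ltW.
Qed.

Let defect k : R := k%:R - mass k.

(** [defect] is concave and nonnegative at [p], hence [defect k / (p - k)] is nondecreasing in [k].
    Up to the factor [1 + r] this quotient is [bypass k]. *)
Let defect_slope j : (j < p)%N ->
  j%:R * defect (p - j.+1) <= j.+1%:R * defect (p - j).
Proof.
elim: j => [|j IH] jp.
  by rewrite mul0r mul1r subn0 /defect subr_ge0.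
have := IH (ltnW jp).
have e1 : (p - j = (p - j.+2).+2)%N by lia.
have e2 : (p - j.+1 = (p - j.+2).+1)%N by lia.
have := @mass_convex (p - j.+2); rewrite -e1 -e2 => /(_ (leq_subr _ _)).
rewrite /defect.
have -> : (p - j.+2)%:R = p%:R - j%:R - 2 :> R by rewrite natrB// -addn2 natrD; ring.
have -> : (p - j.+1)%:R = p%:R - j%:R - 1 :> R by rewrite natrB 1?ltnW// -addn1 natrD; ring.
have -> : (p - j)%:R = p%:R - j%:R :> R by rewrite natrB// (ltnW (ltnW jp)).
have -> : j.+2%:R = j%:R + 2 :> R by rewrite -natrD addn2.
have -> : j.+1%:R = j%:R + 1 :> R by rewrite natr1.
have : 0 <= j%:R :> R by [].
move: (j%:R) (mass (p - j)) (mass (p - j.+1)) (mass (p - j.+2)) => x a b c x0 conv H.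
have : 0 <= (x + 1) * (c + a - 2 * b) by apply: mulr_ge0; [rewrite addr_ge0|rewrite subr_ge0].
lra.
Qed.

Let bypass_mono k : (k.+1 < p)%N -> bypass k <= bypass k.+1.
Proof.
move=> kp; have := @defect_slope (p - k.+1).
have -> : (p - k.+1).+1 = (p - k)%N by lia.
have -> : (p - (p - k.+1) = k.+1)%N by lia.
have -> : (p - (p - k) = k)%N by lia.
have := lt_kn kp; have -> : k.+1%:R = k%:R + 1 :> R by rewrite natr1.
move=> kp' /(_ ltac:(lia)).
rewrite natrB 1?ltnW// natrB; last by lia.
have -> : k.+1%:R = k%:R + 1 :> R by rewrite natr1.
rewrite /bypass -!/(defect _) => H.
rewrite ler_pdivrMr ?mulr_gt0//; last by lra.
rewrite mulrAC ler_pdivlMr; last by rewrite mulr_gt0// -natr1; lra.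
rewrite -natr1 mulrCA [leRHS]mulrCA ler_pM2l//; lra.
Qed.

Let bypass_ge0 k : (k < p)%N -> 0 <= bypass k.
Proof.
elim: k => [|k IH] kp; first by rewrite /bypass mass0 subr0 mul0r.
exact: le_trans (IH (ltnW kp)) (bypass_mono kp).
Qed.

Let direct_rate0 : direct_rate 0 = 0.
Proof. by rewrite /direct_rate /direct /bypass mass0 subr0 mul0r subr0 mul0r. Qed.

Let direct_rate_ge0 k : (k < p)%N -> 0 <= direct_rate k.
Proof.
case: k => [|k] kp; first by rewrite direct_rate0.
by apply: divr_ge0; [exact: direct_pos|have := (lt_kn kp, pnR, p1R); case=> -[]; lra].
Qed.

(** This makes the coefficient [c] of [Th p - Th k] in the induction step nonpositive, so that
    monotonicity of [Th] absorbs what is left of that term. *)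
Lemma direct_rate_le k : (k < p)%N -> direct_rate k * r <= weight k.
Proof.
move=> kp; have L := lt_kn kp; have N2 := pnR; have N1 := p1R.
have v0 : 0 < n%:R - k%:R + 1 :> R by lra.
rewrite /direct_rate mulrAC ler_pdivrMr//.
apply: (@le_trans _ _ (mass k * r)).
  by rewrite ler_pM2r// /direct lerBlDr lerDl bypass_ge0.
rewrite -(ler_pM2r h0) mulrAC massE.
have -> : weight k * (n%:R - k%:R + 1) * (1 + r) = (weight k * (1 + (n%:R - k%:R) * (1 + r)) - 1) * r
   + (weight k * ((n%:R - k%:R) * (1 + r) * (1 - r) + 1) + r) by ring.
rewrite lerDl addr_ge0 ?(ltW r0)// mulr_ge0 ?(ltW (weight_gt0 _))//.
have v1 : 0 <= n%:R - k%:R :> R by lra.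
by rewrite addr_ge0// !mulr_ge0 ?(ltW h0)// subr_ge0 ltW.
Qed.

(** The cancellation of [F k]: divided by [n - k], the left side is the weight with which [F k]
    enters through the two jumps, and the right side its weight in the recursion of [e], both up to
    the factor [2 (1 + r)]. *)
Let moment k : (k.+1 < p)%N ->
  direct k.+1 + (p%:R - k%:R) * (bypass k.+1 - bypass k) = (n%:R - k%:R) * (r * weight k.+1).
Proof.
move=> kp.
have L := lt_kn kp; rewrite -natr1 in L.
have bypassE i : (i < p)%N -> bypass i * (p%:R - i%:R) * (1 + r) = i%:R - mass i.
  move=> ip; have := lt_kn ip => Li.
  by rewrite -mulrA /bypass [_ * (1 + r)]mulrC divfK// mulf_neq0// lt0r_neq0//; lra.
have B0 := bypassE k (ltnW kp); have := bypassE _ kp; rewrite -natr1 => B1.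
have M0 := massE k; have M1 := massE k.+1; rewrite (weightS (ltnW kp)) in M0.
rewrite -natr1 in M1.
have h2 : (1 + r) ^+ 2 != 0 by rewrite expf_neq0// gt_eqF.
apply: (mulfI h2).
have -> : (1 + r) ^+ 2 * (direct k.+1 + (p%:R - k%:R) * (bypass k.+1 - bypass k)) =
  (1 + r) * (mass k.+1 * (1 + r)) + (1 + r) * (bypass k.+1 * (p%:R - (k%:R + 1)) * (1 + r))
   - (1 + r) * (bypass k * (p%:R - k%:R) * (1 + r)) by rewrite /direct; ring.
rewrite B0 B1.
have -> : (1 + r) * (mass k.+1 * (1 + r)) + (1 + r) * (k%:R + 1 - mass k.+1)
   - (1 + r) * (k%:R - mass k) = r * (mass k.+1 * (1 + r)) + (1 + r) + mass k * (1 + r) by ring.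
rewrite M0 M1; ring.
Qed.
Variables (X0 : R) (Th K Z e F : nat -> R).
Hypothesis hK : forall k, (k <= p)%N -> K k = Th k + (n%:R - k%:R) * Z k.
Hypothesis hTh : forall k, Th k <= Th k.+1.
Hypothesis hK0 : K 0 = X0 - e 0%N.
Hypothesis he : forall k, e k.+1 = r ^+ 2 * e k + K k - K k.+1 - 2 * r * (1 + r) * F k.
Hypothesis hT : forall i l, (i <= l <= p)%N ->
  (l%:R - i%:R) * (Z i - Z l) <= K l - K i + 2 * (1 + r) * (l%:R - i%:R) * F i.

Lemma Th_mono k : (k <= p)%N -> Th k <= Th p.
Proof.
by move=> /subnK <-; elim: (p - k)%N => [//|j IH]; rewrite addSn; apply: le_trans (hTh _).
Qed.

Let direct_rateE k : (k <= p)%N -> direct_rate k * (n%:R - k%:R + 1) = direct k.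
Proof.
move=> kp; rewrite /direct_rate divfK// gt_eqF//.
have : k%:R <= p%:R :> R by rewrite ler_nat.
have := pnR; have := p1R.
lra.
Qed.

(** [Th], [K] and [e] stand for [Theta], [energy] and [residual_energy] of a trajectory, [Z k] for
    [|z_k|^2 / (n - k)] and [X0] for [|z_0 + g_0|^2]. At [k = 0] the two sides are equal, because
    the equation of [r] gives [mass 0 = 0]. The index stops at [p - 1] since [bypass] has the
    denominator [p - k]. *)
Lemma first_part_invariant k : (k < p)%N ->
  - (weight k - direct_rate k) * (Th p - Th k) + (weight k * (n%:R - k%:R) - direct k) * Z k - bypass k * Z p <=
  weight 0 * (X0 - Th p) - weight k * e k.
Proof.
elim: k => [|k IH] kp.
  have : direct 0 = 0 by rewrite /direct /bypass mass0 subr0 mul0r subr0.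
  have : bypass 0 = 0 by rewrite /bypass mass0 subr0 mul0r.
  have -> : X0 = Th 0%N + (n%:R - 0%:R) * Z 0%N + e 0%N by rewrite -hK// hK0 subrK.
  by rewrite direct_rate0 => -> ->; lra.
have {}IH := IH (ltnW kp).
have L := lt_kn kp; have N2 := pnR; have N1 := p1R; have Es : k.+1%:R = k%:R + 1 :> R by rewrite natr1.
rewrite Es in L; have vpos : 0 < n%:R - k%:R :> R by lra.
pose v : R := n%:R - k%:R; pose q : R := p%:R - k%:R.
pose b := (bypass k.+1 - bypass k) / v.
have v0 : 0 < v by [].
have bE : bypass k.+1 = bypass k + b * v by rewrite /b divfK ?gt_eqF//; ring.
have b0 : 0 <= b by apply: divr_ge0; [rewrite subr_ge0 bypass_mono|exact: ltW].
have aE : direct k.+1 = direct_rate k.+1 * v by rewrite -(direct_rateE (ltnW kp)) Es /v; congr (_ * _); ring.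
have dE : direct k = direct_rate k * (v + 1) by rewrite -(direct_rateE (ltnW (ltnW kp))).
have a0 := direct_rate_ge0 kp.
have ru : r * weight k.+1 = direct_rate k.+1 + q * b.
  apply: (mulfI (lt0r_neq0 v0)); rewrite -(moment kp) aE bE /q; ring.
have uE := weightS (ltnW kp).
pose c := direct_rate k.+1 + b - direct_rate k + weight k - weight k.+1.
have cE : c * v = direct_rate k - r * weight k.+1.
  have M1 := massE k.+1; have M0 := massE k.
  have m1 : mass k.+1 = direct_rate k.+1 * v + bypass k + b * v by rewrite -aE -addrA -bE /direct subrK.
  have m0 : mass k = direct_rate k * (v + 1) + bypass k by rewrite -dE /direct subrK.
  rewrite Es m1 in M1; rewrite m0 -/v in M0.
  apply: (mulIf (lt0r_neq0 h0)).
  have -> : c * v * (1 + r) = (direct_rate k.+1 * v + bypass k + b * v) * (1 + r) - (direct_rate k * (v + 1) + bypass k) * (1 + r)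
    + (direct_rate k + (weight k - weight k.+1) * v) * (1 + r) by rewrite /c; ring.
  rewrite M1 M0 uE /v; ring.
have c0 : c <= 0.
  rewrite -(pmulr_lle0 _ v0) cE subr_le0.
  have := direct_rate_le (ltnW kp); rewrite uE => H.
  by rewrite -(ler_pM2r r0); apply: le_trans H _; rewrite le_eqVlt; apply/orP; left; apply/eqP; ring.
have T1 : (k%:R + 1 - k%:R) * (Z k - Z k.+1) <=
    K k.+1 - K k + 2 * (1 + r) * (k%:R + 1 - k%:R) * F k.
  by rewrite -Es; apply: hT; rewrite leqnSn ltnW.
have T2 : q * (Z k - Z p) <= K p - K k + 2 * (1 + r) * q * F k.
  by apply: hT; rewrite leqnn ltnW// ltnW.
have P1 : 0 <= direct_rate k.+1 * (K k.+1 - K k + 2 * (1 + r) * F k - (Z k - Z k.+1)).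
  by apply: mulr_ge0; [exact: a0|move: T1; lra].
have P2 : 0 <= b * (K p - K k + 2 * (1 + r) * q * F k - q * (Z k - Z p)).
  by apply: mulr_ge0; [exact: b0|rewrite subr_ge0].
have P3 : 0 <= - c * (Th p - Th k).
  by apply: mulr_ge0; [lra | rewrite subr_ge0 Th_mono// (ltnW (ltnW kp))].
have E1 : c * v * Z k = (direct_rate k - r * weight k.+1) * Z k by rewrite cE.
have ar : direct_rate k.+1 = r * weight k.+1 - q * b by rewrite ru addrK.
have Kp := hK (leqnn p).
have K1 := hK (ltnW kp : k.+1 <= p)%N; have K0 := hK (ltnW (ltnW kp) : k <= p)%N.
rewrite he aE bE Es; rewrite dE uE in IH; rewrite Es in K1.
have nk : n%:R - k%:R = v by []. have pk : p%:R - k%:R = q by [].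
have nk1 : n%:R - (k%:R + 1) = v - 1 by rewrite /v; ring.
rewrite nk1 in K1 *; rewrite nk in IH K0.
have np : n%:R - p%:R = v - q by rewrite /v /q; ring.
rewrite np in Kp; rewrite {}K1 {}K0 {}Kp in P1 P2 *.
rewrite /c uE in P3 E1.
rewrite {}ar in P1 P3 E1 *.
exact: (first_step_alg IH P1 P2 P3 E1).
Qed.
End FirstPart.

(** * Scalar induction for the second half *)

Lemma bernoulli_inequality (R : realFieldType) (a : R) n : 0 <= a -> 1 + n%:R * a <= (1 + a) ^+ n.
Proof.
move=> a0; elim: n => [|n IH]; first by rewrite expr0 mul0r addr0.
have : 0 <= a * (n%:R * a) by rewrite !mulr_ge0.
have : 0 <= (1 + a) * ((1 + a) ^+ n - (1 + n%:R * a)) by rewrite mulr_ge0 ?subr_ge0// addr_ge0.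
by rewrite [(1 + a) ^+ n.+1]exprS -[n.+1%:R]natr1; lra.
Qed.

(** The conclusion is the last hypothesis plus [a] times the forward step, [x] times the backward
    step and [q] times the long step. The equation for [y * q] is the cancellation of [gam]. *)
Lemma second_step_alg (R : realFieldType) (r x q p y f f' fn g d gam s V : R) :
  let w := (1 + r) * x + 1 + (1 + r) * (p + q) in
  let a := w - x - q in
  y * q = a - x - (p + q) ->
  0 <= a -> 0 <= x -> 0 <= q ->
  gam - d <= 2 * (f - f') -> 2 * r * (f - f') <= gam + d ->
  2 * (r * f + f' - (1 + r) * fn) <= y * gam + (gam + s) + d ->
  0 <= V - r ^+ 2 * w * g - 2 * f + p * (gam + s - 2 * (1 + r) * (f - fn)) ->
  0 <= V - w * (r ^+ 2 * g - d) - 2 * f' + (p + q) * (s - 2 * (1 + r) * (f' - fn)).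
Proof.
move=> w a yq a0 x0 q0; rewrite -subr_ge0 => H1; rewrite -subr_ge0 => H2; rewrite -subr_ge0 => H3 H.
have := addr_ge0 (addr_ge0 H (mulr_ge0 a0 H1)) (addr_ge0 (mulr_ge0 x0 H2) (mulr_ge0 q0 H3)).
move=> {}H; apply: le_trans H _; rewrite le_eqVlt; apply/orP; left; apply/eqP.
have -> : q * (y * gam + (gam + s) + d - 2 * (r * f + f' - (1 + r) * fn)) =
  y * q * gam + q * (gam + s + d - 2 * (r * f + f' - (1 + r) * fn)) by ring.
rewrite yq /a /w; ring.
Qed.

Section SecondPart.
Variables (R : realFieldType) (r : R) (n : nat).
Hypothesis r01 : 0 < r < 1.
Hypothesis rn : r ^+ n * (1 + n%:R * (1 + r)) = 1.

(* back_weight k and Phi k are the multipliers of |g_k|^2 and of the tail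
   |z_k - z_(k+1)|^2 + ... + |z_(n-1) - z_n|^2 in the invariant second_inv. *)
Definition back_weight k : R := r ^- (2 * k - n).
Definition Psi k : R := ((2 * k%:R - n%:R) - (back_weight k - 1) / (1 + r)) / (1 + r).
Definition Phi k : R := Psi k / (n%:R - k%:R).

Let r0 : 0 < r. Proof. by case/andP: r01. Qed.
Let r1 : r < 1. Proof. by case/andP: r01. Qed.
Let h0 : 0 < 1 + r. Proof. by rewrite addr_gt0. Qed.
Let hN0 : 1 + r != 0. Proof. exact: lt0r_neq0. Qed.

Let back_gt0 k : 0 < back_weight k.
Proof. by rewrite invr_gt0 exprn_gt0. Qed.

Let backS k : (n <= 2 * k)%N -> back_weight k = r ^+ 2 * back_weight k.+1.
Proof.
move=> nk; rewrite /back_weight; have -> : (2 * k.+1 - n = 2 + (2 * k - n))%N by lia.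
by rewrite exprD invfM mulrA mulfV ?mul1r// expf_neq0// lt0r_neq0.
Qed.

Let back_n : back_weight n = 1 + n%:R * (1 + r).
Proof.
rewrite /back_weight; have -> : (2 * n - n = n)%N by lia.
have rN : r ^+ n != 0 by rewrite expf_neq0// lt0r_neq0.
by apply: (mulfI rN); rewrite mulfV.
Qed.

Let PsiE k : Psi k * (1 + r) ^+ 2 = (2 * k%:R - n%:R) * (1 + r) - (back_weight k - 1).
Proof.
rewrite /Psi expr2 mulrA divfK// mulrBl divfK//.
Qed.

(** Bernoulli's inequality for [r^(-2 (n - k))], scaled by the exact value of [back_weight n]. After
    clearing denominators it is the monotonicity of [Phi]. *)
Let back_bernoulli k : (n <= 2 * k)%N -> (k <= n)%N ->
  back_weight k.+1 * (r ^+ 2 + (n%:R - k%:R) * (1 - r ^+ 2)) <= 1 + n%:R * (1 + r).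
Proof.
move=> nk kn; rewrite -back_n.
have E : back_weight n = back_weight k * (r ^- 2) ^+ (n - k).
  rewrite /back_weight -[r ^- 2]exprVn -exprM -!exprVn -exprD; congr (_ ^+ _); lia.
rewrite E; have r2 : 0 < r ^+ 2 by exact: exprn_gt0.
have r2' : r ^+ 2 <= 1 by rewrite exprn_ile1// ltW.
have := @bernoulli_inequality R (r ^- 2 - 1) (n - k).
rewrite subr_ge0 invf_ge1// => /(_ r2'); rewrite [1 + (_ - 1)]addrC subrK natrB// => B.
apply: le_trans (ler_wpM2l (ltW (back_gt0 k)) B).
rewrite (backS nk) [r ^+ 2 * _]mulrC -mulrA ler_pM2l//.
rewrite [leRHS]mulrDr mulr1 lerD2l mulrCA ler_wpM2l ?subr_ge0 ?ler_nat//.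
by rewrite mulrBr mulfV ?mulr1// lt0r_neq0.
Qed.

Variables (V : R) (F G d Gam S : nat -> R) (i0 : nat).
Hypothesis ni0 : (n <= 2 * i0)%N.
Hypothesis i0n : (i0 < n)%N.
Hypothesis transport : forall k, (i0 <= k <= n)%N ->
  1 + k%:R * (1 + r) <= back_weight k * (1 + (n%:R - k%:R) * (1 + r)).
Hypothesis Psi0 : 0 <= Psi i0.
Hypothesis GS : forall k, G k.+1 = r ^+ 2 * G k - d k.
Hypothesis SS : forall k, (k < n)%N -> S k = Gam k + S k.+1.
Hypothesis Sn : S n = 0.
Hypothesis Ha : forall k, Gam k - d k <= 2 * (F k - F k.+1).
Hypothesis Hb : forall k, 2 * r * (F k - F k.+1) <= Gam k + d k.
Hypothesis Hc : forall k, (k < n)%N -> 2 * (r * F k + F k.+1 - (1 + r) * F n) <=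
  (n%:R - 1 - k%:R) * Gam k + S k + d k.
Hypothesis Fn : 0 <= F n.

Definition second_inv k := 0 <= V - back_weight k * G k - 2 * F k
  + Phi k * (S k - 2 * (1 + r) * (F k - F n)).

Let PhiE k : (k < n)%N -> Phi k * (n%:R - k%:R) = Psi k.
Proof. by move=> kn; rewrite /Phi divfK// subr_eq0 eqr_nat gtn_eqF. Qed.

Let PsiS k : (n <= 2 * k)%N -> (Psi k.+1 - Psi k) * (1 + r) = 2 - (1 - r) * back_weight k.+1.
Proof.
move=> nk; apply: (mulIf hN0); rewrite -mulrA -expr2 mulrBl !PsiE (backS nk) -[k.+1%:R]natr1; ring.
Qed.

Let Phi_le k : (i0 <= k)%N -> (k.+1 < n)%N -> Phi k <= Phi k.+1.
Proof.
move=> ik kn; have nk : (n <= 2 * k)%N by lia.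
have kn' : k%:R + 1 + 1 <= n%:R :> R by rewrite !natr1 ler_nat.
have v0 : 0 < n%:R - k%:R :> R by lra.
have v1 : 0 < n%:R - k.+1%:R :> R by rewrite -natr1; lra.
rewrite /Phi ler_pdivrMr// mulrAC ler_pdivlMr//.
have P1 := PsiS nk; have P0 := PsiE k; have := back_bernoulli nk (ltnW (ltnW kn)).
rewrite (backS nk) in P0.
rewrite -subr_ge0 => B; rewrite -[k.+1%:R]natr1 -subr_ge0.
have h2 : 0 < (1 + r) ^+ 2 by rewrite exprn_gt0.
rewrite -(pmulr_lge0 _ h2).
have -> : (Psi k.+1 * (n%:R - k%:R) - Psi k * (n%:R - (k%:R + 1))) * (1 + r) ^+ 2 =
  ((Psi k.+1 - Psi k) * (1 + r)) * (1 + r) * (n%:R - k%:R) + Psi k * (1 + r) ^+ 2 by ring.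
rewrite P1 P0; apply: le_trans B _; rewrite le_eqVlt; apply/orP; left; apply/eqP; ring.
Qed.

Let Phi_ge0 k : (i0 <= k < n)%N -> 0 <= Phi k.
Proof.
case/andP => ik; rewrite -(subnK ik); elim: (k - i0)%N => [|j IH] jn.
  by rewrite /Phi divr_ge0// subr_ge0 ler_nat ltnW.
by rewrite addSn; apply: le_trans (IH (ltnW jn)) (Phi_le _ _) => //; rewrite leq_addl.
Qed.

(** The multiplier of the backward step in [stepP]. After clearing denominators, its nonnegativity
    is exactly [transport]. *)
Let slack k : R := (back_weight k - 1) / (1 + r) - Psi k / (n%:R - k%:R).

Let slack_ge0 k : (i0 <= k < n)%N -> 0 <= slack k.
Proof.
case/andP => ik kn; rewrite /slack subr_ge0.
have kn' : k%:R + 1 <= n%:R :> R by rewrite natr1 ler_nat.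
have v0 : 0 < n%:R - k%:R :> R by lra.
have h2 : 0 < (1 + r) ^+ 2 by rewrite exprn_gt0.
rewrite ler_pdivrMr// -(ler_pM2r h2) PsiE.
have -> : (back_weight k - 1) / (1 + r) * (n%:R - k%:R) * (1 + r) ^+ 2 = (back_weight k - 1) * (n%:R - k%:R) * (1 + r).
  by field.
have := transport (k := k); rewrite ik (ltnW kn) => /(_ isT); lra.
Qed.

Let stepP k : (i0 <= k)%N -> (k.+1 < n)%N -> second_inv k -> second_inv k.+1.
Proof.
move=> ik kn; have nk : (n <= 2 * k)%N by lia.
have X0 : 0 <= slack k.+1 by rewrite slack_ge0// ltnW.
have Q0 : 0 <= Phi k.+1 - Phi k by rewrite subr_ge0 Phi_le.
have P0 : 0 <= Phi k by rewrite Phi_ge0// ik ltnW.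
have xE : (1 + r) * slack k.+1 + 1 + (1 + r) * (Phi k + (Phi k.+1 - Phi k)) = back_weight k.+1.
  rewrite [Phi k + _]addrC subrK /slack -/(Phi _) mulrBr mulrC divfK//; ring.
have := @second_step_alg R r (slack k.+1) (Phi k.+1 - Phi k) (Phi k)
  (n%:R - 1 - k%:R) (F k) (F k.+1) (F n) (G k) (d k) (Gam k) (S k.+1) V.
rewrite /= xE [Phi k + _]addrC subrK => step.
rewrite /second_inv (backS nk) GS (SS (ltnW kn)); apply: step => //.
- apply: (mulfI hN0).
  have := PsiS nk; rewrite -!PhiE// 1?ltnW// -[k.+1%:R]natr1 => E.
  have xE' : (1 + r) * slack k.+1 = back_weight k.+1 - 1 - (1 + r) * Phi k.+1.
    by rewrite -xE; ring.
  have -> : (1 + r) * (back_weight k.+1 - slack k.+1 - (Phi k.+1 - Phi k) - slack k.+1 - Phi k.+1)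
     = (1 + r) * back_weight k.+1 - 2 * ((1 + r) * slack k.+1) - (1 + r) * (2 * Phi k.+1 - Phi k) by ring.
  rewrite xE'.
  have -> : (1 + r) * ((n%:R - 1 - k%:R) * (Phi k.+1 - Phi k)) =
    (Phi k.+1 * (n%:R - (k%:R + 1)) - Phi k * (n%:R - k%:R)) * (1 + r) + (1 + r) * Phi k by ring.
  rewrite E; ring.
- have -> : back_weight k.+1 - slack k.+1 - (Phi k.+1 - Phi k) = 1 + r * slack k.+1 + r * Phi k.+1 + Phi k.
    by rewrite -xE; ring.
  by rewrite !addr_ge0// mulr_ge0// ?(ltW r0)//; apply: le_trans P0 (Phi_le _ _).
- by have := Hc (ltnW kn); rewrite (SS (ltnW kn)).
Qed.

Lemma second_part : second_inv i0 -> back_weight n * G n <= V.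
Proof.
move=> H0.
have : second_inv n.-1.
  have : (i0 <= n.-1)%N by lia.
  move=> /subnK <-; have : (n.-1 - i0 + i0 < n)%N by lia.
  elim: (n.-1 - i0)%N => [//|j IH] jn; rewrite addSn; apply: stepP => //.
    by rewrite leq_addl.
  by apply: IH; exact: ltnW.
have nE : n.-1.+1 = n by rewrite prednK//; lia.
have nR : n.-1%:R = n%:R - 1 :> R by rewrite -[in RHS]nE -natr1 addrK.
have nk : (n <= 2 * n.-1)%N by lia.
have PhiN : Phi n.-1 = n%:R * (1 - r) - 1.
  have := PhiE (k := n.-1); rewrite nE leqnn => /(_ isT).
  rewrite nR opprB addrC subrK mulr1 => ->.
  have h2 : (1 + r) ^+ 2 != 0 by rewrite expf_neq0.
  by apply: (mulIf h2); rewrite PsiE (backS nk) nE back_n nR; ring.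
have A := Ha n.-1; have B := Hb n.-1; have C := GS n.-1; rewrite nE in A B C.
rewrite /second_inv SS ?nE// Sn addr0 (backS nk) nE PhiN back_n C.
have P0 : 0 <= n%:R * (1 - r) - 1 by rewrite -PhiN; apply: Phi_ge0; lia.
move=> H.
have c1 : 0 <= 1 + n%:R * r by rewrite addr_ge0// mulr_ge0// ltW.
have F0 := Fn.
(* From [n - 1] to [n] the forward and backward steps enter with multipliers [n] and [1 + n r]. The
   terms in [Gam] and [F n.-1] cancel, and only [- 2 F n] is left over. *)
have P1 : 0 <= n%:R * (2 * (F n.-1 - F n) - (Gam n.-1 - d n.-1)) by rewrite mulr_ge0// subr_ge0.
have P2 : 0 <= (1 + n%:R * r) * (Gam n.-1 + d n.-1 - 2 * r * (F n.-1 - F n)).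
  by rewrite mulr_ge0// subr_ge0.
lra.
Qed.
End SecondPart.

(** * Inner products and the energy along a trajectory *)

Section Dot.
Variables (R : realFieldType) (d : nat).
Implicit Types x y z : 'rV[R]_d.

Definition dot x y : R := \sum_(i < d) x 0 i * y 0 i.

Lemma dotC x y : dot x y = dot y x.
Proof. by apply: eq_bigr => i _; rewrite mulrC. Qed.

Lemma dotDl x y z : dot (x + y) z = dot x z + dot y z.
Proof. by rewrite /dot -big_split; apply: eq_bigr => i _; rewrite mxE mulrDl. Qed.

Lemma dotZl a x y : dot (a *: x) y = a * dot x y.
Proof. by rewrite /dot mulr_sumr; apply: eq_bigr => i _; rewrite mxE mulrA. Qed.

Lemma dotNl x y : dot (- x) y = - dot x y.
Proof. by rewrite -scaleN1r dotZl mulN1r. Qed.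

Lemma dotBl x y z : dot (x - y) z = dot x z - dot y z.
Proof. by rewrite dotDl dotNl. Qed.

Lemma dotDr x y z : dot x (y + z) = dot x y + dot x z.
Proof. by rewrite dotC dotDl !(dotC _ x). Qed.

Lemma dotZr a x y : dot x (a *: y) = a * dot x y.
Proof. by rewrite dotC dotZl dotC. Qed.

Lemma dotNr x y : dot x (- y) = - dot x y.
Proof. by rewrite dotC dotNl dotC. Qed.

Lemma dotBr x y z : dot x (y - z) = dot x y - dot x z.
Proof. by rewrite dotDr dotNr. Qed.

Definition dotE := (dotDl, dotDr, dotBl, dotBr, dotZl, dotZr, dotNl, dotNr).

Lemma dot0l x : dot 0 x = 0.
Proof. by rewrite -(scale0r 0) dotZl mul0r. Qed.

Lemma dot_ge0 x : 0 <= dot x x.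
Proof. by apply: sumr_ge0 => i _; rewrite -expr2 sqr_ge0. Qed.

Lemma dot_suml (I : Type) (s : seq I) (f : I -> 'rV[R]_d) y :
  dot (\sum_(i <- s) f i) y = \sum_(i <- s) dot (f i) y.
Proof.
elim: s => [|i s IH]; first by rewrite !big_nil dot0l.
by rewrite !big_cons dotDl IH.
Qed.

Lemma dot_mul2_le x y : 2 * dot x y <= dot x x + dot y y.
Proof.
have := dot_ge0 (x - y); rewrite !dotE (dotC y x) => H; lra.
Qed.

(** [a b] times the right side minus the left side is [|b x - a y|^2]. *)
Lemma dot_weighted (a b : R) x y : 0 < b -> b < a ->
  (a - b) * (dot x x / a - dot y y / b) <= dot (x - y) (x - y).
Proof.
move=> b0 ba; have a0 : 0 < a by exact: lt_trans ba.
have := dot_ge0 (b *: x - a *: y); rewrite -(pmulr_rge0 _ (mulr_gt0 a0 b0)) => H.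
rewrite -subr_ge0 -(pmulr_rge0 _ (mulr_gt0 a0 b0)).
have H' := dot_ge0 (b *: x - a *: y).
apply: le_trans H' _; rewrite le_eqVlt; apply/orP; left; apply/eqP.
rewrite !dotE (dotC y x); field.
by rewrite !lt0r_neq0.
Qed.
End Dot.

Section Trajectory.
Variables (R : realFieldType) (d : nat) (r : R) (z g : nat -> 'rV[R]_d) (F : nat -> R).
Hypothesis hz : forall k, z k - z k.+1 = r *: g k + g k.+1.
Hypothesis hQ : forall i j, dot (g j) (z i - z j) <= F i - F j.
Hypothesis hA : forall j, F j <= dot (g j) (z j).
Hypothesis r0 : 0 < r.

Definition gap j : R := dot (g j) (z j) - F j.
(** Accumulated slack in [F_j <= <g_j, z_j>], with the weights that make [residual_energyS] an
    identity. *)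
Fixpoint Theta k : R :=
  if k is j.+1 then Theta j + 2 * gap j.+1 + 2 * r * gap j else 2 * gap 0.
Definition energy k : R := Theta k + dot (z k) (z k).
Definition residual_energy k : R := 2 * F k + dot (g k) (g k).

Let zE k : z k = z k.+1 + (r *: g k + g k.+1).
Proof. by rewrite -hz addrC subrK. Qed.

Lemma gap_ge0 j : 0 <= gap j.
Proof. by rewrite subr_ge0. Qed.

Lemma Theta_ge0 k : 0 <= Theta k.
Proof.
elim: k => [|k IH] /=; first by rewrite mulr_ge0// gap_ge0.
by rewrite !addr_ge0// ?mulr_ge0 ?gap_ge0// ltW.
Qed.

Lemma Theta_le k : Theta k <= Theta k.+1.
Proof. by rewrite /= -addrA lerDl addr_ge0// ?mulr_ge0 ?gap_ge0// ltW. Qed.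

Lemma energy0E : energy 0 = dot (z 0 + g 0) (z 0 + g 0) - residual_energy 0.
Proof. rewrite /energy /residual_energy /= /gap !dotE (dotC (z 0) (g 0)); ring. Qed.

Lemma residual_energyS k : residual_energy k.+1 = r ^+ 2 * residual_energy k + energy k - energy k.+1 - 2 * r * (1 + r) * F k.
Proof.
rewrite /energy /residual_energy /= /gap (zE k) !dotE.
rewrite (dotC (g k.+1) (g k)) (dotC (z k.+1) (g k)) (dotC (z k.+1) (g k.+1)); ring.
Qed.

(** Passing from [k] to [k + 1] adds [hQ i k.+1] with multiplier 2 and [hQ i k] with multiplier
    [2 r]. By [hz] the two gradients then combine to [z k - z k.+1], and [2 <z_i, z_k - z_(k+1)>] is
    the increment of [|z_i - z_l|^2 - |z_l|^2] in [l]. *)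
Lemma energy_jump i l : (i <= l)%N ->
  dot (z i - z l) (z i - z l) <= energy l - energy i + 2 * (1 + r) * (l%:R - i%:R) * F i.
Proof.
move=> /subnK <-; elim: (l - i)%N => [|j IH].
  by rewrite add0n !subrr dot0l mulr0 mul0r addr0.
set k := (j + i)%N in IH *; rewrite addSn -/k.
rewrite -subr_ge0 in IH.
have H1 := hQ i k.+1; have H2 := hQ i k; rewrite -subr_ge0 in H1; rewrite -subr_ge0 in H2.
have := addr_ge0 IH (addr_ge0 (mulr_ge0 (ler0n R 2) H1) (mulr_ge0 (ltW (mulr_gt0 (ltr0Sn R 1) r0)) H2)).
move=> H; rewrite -subr_ge0; apply: le_trans H _.
rewrite le_eqVlt; apply/orP; left; apply/eqP.
rewrite /energy /= /gap (zE k) -[k.+1%:R]natr1 !dotE.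
rewrite (dotC (g k.+1) (g k)) (dotC (z k.+1) (g k)) (dotC (z k.+1) (g k.+1)) (dotC (z i) (g k))
  (dotC (z i) (g k.+1)) (dotC (z k.+1) (z i)); ring.
Qed.

Definition step_sqnorm k : R := dot (z k - z k.+1) (z k - z k.+1).
Definition residual_drop k : R := r ^+ 2 * dot (g k) (g k) - dot (g k.+1) (g k.+1).

(** By [hz], [step_sqnorm k - residual_drop k] is [2 <g_(k+1), z_k - z_(k+1)>], and the sum of the
    two is [2 r <g_k, z_k - z_(k+1)>]. This lemma and the next are [hQ] between neighbours in these
    variables. *)
Lemma forward_step k : step_sqnorm k - residual_drop k <= 2 * (F k - F k.+1).
Proof.
have := hQ k k.+1; rewrite -(ler_pM2l (ltr0Sn R 1)) => H; apply: le_trans _ H.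
rewrite le_eqVlt; apply/orP; left; apply/eqP.
rewrite /step_sqnorm /residual_drop hz !dotE (dotC (g k.+1) (g k)); ring.
Qed.

Lemma backward_step k : 2 * r * (F k - F k.+1) <= step_sqnorm k + residual_drop k.
Proof.
have := hQ k.+1 k; rewrite -subr_ge0 -(pmulr_rge0 _ (mulr_gt0 (ltr0Sn R 1) r0)) => H.
rewrite -subr_ge0; apply: le_trans H _; rewrite le_eqVlt; apply/orP; left; apply/eqP.
rewrite -(opprB (z k)) /step_sqnorm /residual_drop hz !dotE (dotC (g k.+1) (g k)); ring.
Qed.

Variable n : nat.
Definition tail_sqnorm k : R := \sum_(k <= l < n) step_sqnorm l.

(** Comparing [k] and [k + 1] with [n] brings in the product of the step at [k] with [z k.+1 - z n].
    The latter telescopes into [n - 1 - k] steps, and each product of two steps is bounded by half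
    the sum of their squares. *)
Lemma long_step k : (k < n)%N -> 2 * (r * F k + F k.+1 - (1 + r) * F n) <=
  (n%:R - 1 - k%:R) * step_sqnorm k + tail_sqnorm k + residual_drop k.
Proof.
move=> kn.
have H1 := hQ n k; have H2 := hQ n k.+1.
have tele : z k.+1 - z n = \sum_(k.+1 <= l < n) (z l - z l.+1).
  rewrite -opprB -telescope_sumr// -sumrN.
  by apply: eq_bigr => l _; rewrite opprB.
have H3 : 2 * dot (z k - z k.+1) (z k.+1 - z n) <= (n%:R - 1 - k%:R) * step_sqnorm k + \sum_(k.+1 <= l < n) step_sqnorm l.
  rewrite tele dotC dot_suml mulr_sumr.
  have -> : n%:R - 1 - k%:R = (n - k.+1)%:R :> R by rewrite natrB// -natr1; ring.
  rewrite mulr_natl -sumr_const_nat -big_split /= ler_sum// => l _.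
  by rewrite [leRHS]addrC dot_mul2_le.
rewrite /tail_sqnorm big_ltn//.
have E : 2 * dot (z k - z k.+1) (z k.+1 - z n) =
   - 2 * r * dot (g k) (z n - z k) - 2 * dot (g k.+1) (z n - z k.+1) - step_sqnorm k - residual_drop k.
  rewrite /step_sqnorm /residual_drop {1}hz !dotE (zE k) !dotE.
  rewrite (dotC (g k.+1) (g k)) (dotC (z k.+1) (g k)) (dotC (z k.+1) (g k.+1)); ring.
have H1' : 0 <= 2 * r * (F n - F k - dot (g k) (z n - z k)).
  by rewrite mulr_ge0 ?subr_ge0// mulr_ge0// ltW.
rewrite E in H3; lra.
Qed.
End Trajectory.

(** * The two halves for a trajectory, and the residual bound *)

Lemma direct_ge0 (R : realFieldType) (r : R) n p k : 0 < r -> (k < p)%N ->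
  1 + p%:R * (1 + r) <= weight r n k * ((1 + (n%:R - k%:R) * (1 + r)) * (1 + (p%:R - k%:R) * (1 + r))) ->
  0 <= direct r n p k.
Proof.
move=> r0 kp; have h0 : 0 < 1 + r by rewrite addr_gt0.
have q0 : 0 < p%:R - k%:R :> R by rewrite subr_gt0 ltr_nat.
move=> H; rewrite /direct /bypass subr_ge0 ler_pdivrMr ?mulr_gt0// -(ler_pM2r h0).
have M : mass r n k * (1 + r) = weight r n k * (1 + (n%:R - k%:R) * (1 + r)) - 1.
  by rewrite /mass divfK// lt0r_neq0.
rewrite mulrBl [leRHS]mulrAC M; lra.
Qed.

(** Last step of the first half for odd [n]. From [p - 1] the jumps to [p] and to [p + 1] enter with
    multipliers [al] and [b], where [al + 2 b = r^2] cancels [F p.-1]; [nu] weights a comparison of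
    [z_p] with [z_(p+1)]. *)
Lemma odd_step_alg (R : realFieldType) (r v a b nu y s0 X0 t tj tm z zj zm x e f : R) :
  let al := r ^+ 2 - 2 * b in
  let g := (r - al) * (v - 1) - al - (y - nu) * (v - 1) - nu * (v - 2) in
  let c := r ^+ 3 - a - r + al + b in
  let K := t + v * z in let Kj := tj + (v - 1) * zj in let Km := tm + (v - 2) * zm in
  let ej := r ^+ 2 * e + K - Kj - 2 * r * (1 + r) * f in
  let nj := (v - 1) * zj in let nm := (v - 2) * zm in
  c * v = a - r ^+ 2 -> b * v = y * (v - 2) - nu ->
  - (r ^+ 3 - a) * (tj - t) + (r ^+ 3 * v - a * (v + 1)) * z - g * zj <= s0 * (X0 - tj) - r ^+ 3 * e ->
  0 <= al * (Kj - K + 2 * (1 + r) * f - (z - zj)) ->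
  0 <= b * (Km - K + 2 * (1 + r) * 2 * f - 2 * (z - zm)) ->
  0 <= - c * (tj - t) -> 0 <= (y - b) * (tm - tj) ->
  0 <= nu * ((v - 2) * zj + (v - 1) * zm - 2 * x) ->
  r * ej + y * (2 * (x - nm) - (tm - tj)) + (y - nu) * (nj + nm - 2 * x) <= s0 * (X0 - tj).
Proof.
move=> al g c K Kj Km ej nj nm cv bv; rewrite -subr_ge0 => H1 H2 H3 H4 H5 H6.
have := addr_ge0 (addr_ge0 (addr_ge0 H1 H2) (addr_ge0 H3 H4)) (addr_ge0 H5 H6).
move=> H; rewrite -subr_ge0; apply: le_trans H _; rewrite le_eqVlt; apply/orP; left; apply/eqP.
set lhs := (X in X = _); set rhs := (X in _ = X).
have -> : lhs = rhs - (c * v - (a - r ^+ 2)) * z + (b * v - (y * (v - 2) - nu)) * zm.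
  by rewrite /lhs /rhs /nj /nm /ej /Km /Kj /K /c /g /al; ring.
by rewrite cv bv !subrr !mul0r subr0 addr0.
Qed.

(** The sign of the multiplier [r^2 - 2 b] of [odd_first], with denominators cleared. The expression
    is affine in [p]; if the coefficient of [p] is negative, the upper bound on [p] is inserted. As
    [p >= 1], that bound also forces [r >= 54/100], and expanded there the remaining polynomial has
    nonnegative coefficients. *)
Lemma odd_rate_pos (R : realFieldType) (r p : R) : 0 < r < 1 -> 1 <= p ->
  p * (1 - r) ^+ 2 <= r * (r ^+ 2 + 2 * r - 1) ->
  0 <= r ^+ 2 * (p + 2) * (1 + r) ^+ 2
    - 2 * ((1 - r) * (1 + r) * (p + 2 - 2) - ((1 + r) ^+ 2 - 2)).
Proof.
move=> /andP[r0 r1] p1 H.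
have r2 : 0 < (1 - r) ^+ 2 by rewrite exprn_gt0// subr_gt0.
have r54 : 54 / 100 <= r.
  have : (1 - r) ^+ 2 <= r * (r ^+ 2 + 2 * r - 1) by apply: le_trans H; rewrite ler_peMl// ltW.
  by move=> {}H; rewrite leNgt; apply/negP => lt; nra.
have A0 : 0 <= r ^+ 2 + 2 * r - 1 by nra.
have -> : r ^+ 2 * (p + 2) * (1 + r) ^+ 2
    - 2 * ((1 - r) * (1 + r) * (p + 2 - 2) - ((1 + r) ^+ 2 - 2)) =
  p * ((1 + r) * (r ^+ 2 * (1 + r) - 2 * (1 - r))) + (2 * r ^+ 2 * (1 + r) ^+ 2 + 2 * (r ^+ 2 + 2 * r - 1)) by ring.
have [c0|c0] := leP 0 ((1 + r) * (r ^+ 2 * (1 + r) - 2 * (1 - r))).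
  apply: addr_ge0; first by apply: mulr_ge0 => //; exact: le_trans p1.
  apply: addr_ge0; last by rewrite mulr_ge0.
  by apply: mulr_ge0; [apply: mulr_ge0 => //; exact: sqr_ge0 | exact: sqr_ge0].
rewrite -(pmulr_lge0 _ r2) mulrDl mulrAC.
have : 0 <= (r * (r ^+ 2 + 2 * r - 1) - p * (1 - r) ^+ 2) * - ((1 + r) * (r ^+ 2 * (1 + r) - 2 * (1 - r))).
  by apply: mulr_ge0; lra.
suff : 0 <= r * (r ^+ 2 + 2 * r - 1) * ((1 + r) * (r ^+ 2 * (1 + r) - 2 * (1 - r))) +
   (2 * r ^+ 2 * (1 + r) ^+ 2 + 2 * (r ^+ 2 + 2 * r - 1)) * (1 - r) ^+ 2 by lra.
have [t t0 ->] : exists2 t, 0 <= t & r = 54 / 100 + t by exists (r - 54 / 100); lra.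
have T k : 0 <= t ^+ k by apply: exprn_ge0.
have := (T 2, T 3, T 4, T 5, T 6, T 7).
move=> [[[[[]]]]]; lra.
Qed.

Section FirstHalf.
Variables (R : realFieldType) (d : nat) (r : R) (z g : nat -> 'rV[R]_d) (F : nat -> R).
Hypothesis hz : forall k, z k - z k.+1 = r *: g k + g k.+1.
Hypothesis hQ : forall i j, dot (g j) (z i - z j) <= F i - F j.
Hypothesis hA : forall j, F j <= dot (g j) (z j).
Hypothesis hF : forall j, 0 <= F j.
Hypothesis r01 : 0 < r < 1.

Let r0 : 0 < r. Proof. by case/andP: r01. Qed.
Let r1 : r < 1. Proof. by case/andP: r01. Qed.
Let h0 : 0 < 1 + r. Proof. by rewrite addr_gt0. Qed.
Let hN0 : 1 + r != 0. Proof. exact: lt0r_neq0. Qed.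
Let rN0 : r != 0. Proof. exact: lt0r_neq0. Qed.
Let x0 := z 0 + g 0.
Let Th := Theta r z g F.
Let K := energy r z g F.
Let e := residual_energy g F.

Variable n : nat.
Hypothesis rn : r ^+ n * (1 + n%:R * (1 + r)) = 1.
Hypothesis n0 : (0 < n)%N.

Let Z k := dot (z k) (z k) / (n%:R - k%:R).

Let KE k : (k < n)%N -> K k = Th k + (n%:R - k%:R) * Z k.
Proof.
by move=> kn; rewrite /K /energy /Z mulrC divfK// subr_eq0 eqr_nat gtn_eqF.
Qed.

(** [dot_weighted] with the weights [n - i] and [n - l] turns the squared distance of [energy_jump]
    into a difference of values of [Z]. *)
Let jump i l : (i <= l < n)%N ->
  (l%:R - i%:R) * (Z i - Z l) <= K l - K i + 2 * (1 + r) * (l%:R - i%:R) * F i.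
Proof.
case/andP => il ln; apply: le_trans (energy_jump hz hQ r0 il).
have [<-|] := eqVneq i l; first by rewrite !subrr dot0l mul0r.
move=> ne; have il' : (i < l)%N by rewrite ltn_neqAle ne.
have -> : l%:R - i%:R = (n%:R - i%:R) - (n%:R - l%:R) :> R by ring.
apply: dot_weighted; first by rewrite subr_gt0 ltr_nat.
by rewrite ltrD2l ltrN2 ltr_nat.
Qed.

Lemma first_part p k : (2 * p < n)%N \/ (2 * p = n)%N -> (k < p)%N ->
  1 <= (n%:R - p%:R) * (1 - r) + 2 * (1 - r) -> mass r n p <= p%:R ->
  (forall k, (0 < k < p)%N -> 0 <= direct r n p k) ->
  - (weight r n k - direct_rate r n p k) * (Th p - Th k) + (weight r n k * (n%:R - k%:R) - direct r n p k) * Z k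
    - bypass r n p k * Z p <= weight r n 0 * (dot x0 x0 - Th p) - weight r n k * e k.
Proof.
move=> pn kp sp me dp; have p0 : (0 < p)%N by exact: leq_ltn_trans kp.
have pn2 : (2 * p <= n)%N by lia.
have pn' : (p < n)%N by lia.
apply: (@first_part_invariant _ r n p r01 rn pn2 p0 sp me dp (dot x0 x0) Th K Z e F) => //.
- by move=> i ip; apply: KE; exact: leq_ltn_trans pn'.
- by move=> i; apply: Theta_le.
- exact: energy0E.
- by move=> i; apply: residual_energyS.
- by move=> i l /andP[il lp]; apply: jump; rewrite il; exact: leq_ltn_trans pn'.
Qed.

Lemma even_first m : (0 < m)%N -> n = (2 * m)%N -> e m <= r ^+ n * dot x0 x0.
Proof.
move=> m0 nE.
have kn : (m < n)%N by rewrite nE mul2n -addnn -addn1 leq_add2l.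
have kn1 : (m.-1 < n)%N by apply: leq_ltn_trans kn; exact: leq_pred.
have jmp : (m.-1 <= m < n)%N by rewrite leq_pred.
have pn2 : (2 * m <= n)%N by rewrite nE.
have n2k : (n - 2 * m.-1 = 2)%N by rewrite nE -mulnBr -subn1 subKn.
have n2km k : (2 * (m - k) = n - 2 * k)%N by rewrite nE mulnBr.
have r0' := r0; have r1' := r1; have h0' := h0.
have nR : n%:R = 2 * m%:R :> R by rewrite nE natrM.
have mR : 1 <= m%:R :> R by rewrite ler1n.
have sp : 1 <= (n%:R - m%:R) * (1 - r) + 2 * (1 - r).
  have B := root_quadratic_bound n0 r01 rn.
  rewrite -(ler_pM2r h0) nR in B *.
  have : 0 <= (1 - r) * (1 + 3 * r) by apply: mulr_ge0; lra.
  lra.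
have um : weight r n m = 1 by rewrite /weight nE subnn.
have me : mass r n m <= m%:R.
  by rewrite /mass um mul1r [1 + _]addrC addrK mulfK// nR; lra.
have dp k : (0 < k < m)%N -> 0 <= direct r n m k.
  case/andP=> k0 km; apply: direct_ge0 => //.
  have := @even_transport_pos R r m r01; rewrite -nE => /(_ rn (m - k)%N (leq_subr _ _)).
  rewrite -exprM /weight natrD natrB 1?ltnW//.
  rewrite n2km.
  by rewrite nR; have -> : m%:R + (m%:R - k%:R) = 2 * m%:R - k%:R :> R by ring.
have kp : (m.-1 < m)%N by rewrite prednK.
have mk : m.-1%:R = m%:R - 1 :> R by rewrite -[in RHS](prednK m0) -natr1 addrK.
have pn : (2 * m < n)%N \/ (2 * m = n)%N by right.
have IH := first_part pn kp sp me dp.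
have RL := @direct_rate_le R r n m r01 rn pn2 m0 sp me m.-1 kp.
have {}RL : direct_rate r n m m.-1 * r <= weight r n m.-1 by exact: RL.
have u1 : weight r n m.-1 = r ^+ 2 * 1 by rewrite /weight n2k mulr1.
have T : (m%:R - m.-1%:R) * (Z m.-1 - Z m) <=
    K m - K m.-1 + 2 * (1 + r) * (m%:R - m.-1%:R) * F m.-1 by apply: jump.
rewrite u1 in IH RL.
pose v : R := m%:R + 1.
have vE : n%:R - m.-1%:R = v by rewrite nR mk /v; ring.
have K0 := KE kn1; rewrite vE in K0; have K1 := KE kn.
have nm : n%:R - m%:R = v - 1 by rewrite nR /v; ring.
rewrite nm in K1.
have massk : mass r n m.-1 * (1 + r) = r ^+ 2 * (1 + v * (1 + r)) - 1.
  by rewrite /mass divfK// u1 mulr1 vE.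
have bypk : bypass r n m m.-1 * (1 + r) = v - 2 - mass r n m.-1.
  rewrite /bypass mk opprB addrCA subrr addr0 mulr1 divfK// /v; ring.
have bypE : bypass r n m m.-1 = v * (1 - r) - 1.
  apply: (mulIf (mulf_neq0 hN0 hN0)); rewrite mulrA bypk mulrBl massk; ring.
have dirk : direct_rate r n m m.-1 * (v + 1) = direct r n m m.-1.
  by rewrite /direct_rate vE divfK// lt0r_neq0// /v; lra.
have dE : direct r n m m.-1 * (1 + r) = r ^+ 2 * (1 + v * (1 + r)) - 1 - (v * (1 - r) - 1) * (1 + r).
  by rewrite /direct mulrBl massk bypE.
have cv : (r - direct_rate r n m m.-1 + r ^+ 2 - 1) * v = direct_rate r n m m.-1 - r.
  apply: (mulIf hN0).
  have -> : (r - direct_rate r n m m.-1 + r ^+ 2 - 1) * v * (1 + r) =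
    (r + r ^+ 2 - 1) * v * (1 + r) - direct r n m m.-1 * (1 + r) + direct_rate r n m m.-1 * (1 + r).
    by rewrite -dirk; ring.
  rewrite dE; ring.
have u0E : weight r n 0 = r ^+ n by rewrite /weight muln0 subn0.
rewrite vE -dirk u0E in IH.
have mm : m%:R - m.-1%:R = 1 :> R by rewrite mk; ring.
rewrite mm !mul1r mulr1 in T.
have v0 : 0 < v by rewrite /v; lra.
have tt : Th m.-1 <= Th m by rewrite -[in leRHS](prednK m0) /Th Theta_le.
have c0 : r - direct_rate r n m m.-1 + r ^+ 2 - 1 <= 0.
  rewrite -(pmulr_lle0 _ v0) cv subr_le0 -(ler_pM2r r0); apply: le_trans RL _; lra.
(* At [k + 1 = m] the two jumps coincide, hence [q = 1] and [b = 0]. By [bypE] the total coefficient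
   of [Z m] is then zero. *)
have := @first_step_alg R r v 1 0 (direct_rate r n m m.-1) 1 (r ^+ n) (bypass r n m m.-1) (Th m) (Th m.-1)
  (Th m) (Z m.-1) (Z m) (Z m) (F m.-1) (e m.-1) (dot x0 x0) IH.
rewrite !mul0r !mulr0 !mulr1 !mul1r !subr0 !addr0.
have eS : e m = r ^+ 2 * e m.-1 + K m.-1 - K m - 2 * r * (1 + r) * F m.-1.
  by rewrite -[in LHS](prednK m0) /e (residual_energyS _ hz) prednK.
have Th0 : 0 <= r ^+ n * Th m by apply: mulr_ge0; [rewrite exprn_ge0// ltW | apply: Theta_ge0].
rewrite -K0 -K1 bypE => S.
have {}S := S ltac:(rewrite mulr_ge0 ?(ltW r0)//; lra) (lexx 0).
have {}S := S ltac:(rewrite mulr_ge0 ?subr_ge0//; lra).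
have {}S := S ltac:(by rewrite cv).
rewrite eS; lra.
Qed.

(** The coefficients of the mixture serve both halves: they yield the identities [bypE] and [cv] in
    [odd_first], and [Psi r n p.+1 = 1 - y / r - nu] in [odd_second]. *)
Let y : R := (1 - r) / (1 + r).
Let nu : R := 1 - 2 / (1 + r) ^+ 2.
Let G k := dot (g k) (g k).

(* Replaces 2 F_m + |g_m|^2 when n = 2 p + 1 and there is no middle index. *)
Definition middle_potential p : R := 2 * r * (1 + y) * F p + 2 * y * F p.+1 + r * G p
  - y * residual_drop r g p - nu * step_sqnorm z p.

Let yE : y * (1 + r) = 1 - r. Proof. by rewrite /y divfK. Qed.
Let nuE : nu * (1 + r) ^+ 2 = (1 + r) ^+ 2 - 2.
Proof. by rewrite /nu mulrBl divfK ?expf_neq0// mul1r. Qed.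

Lemma odd_first p : (0 < p)%N -> n = (2 * p + 1)%N -> middle_potential p <= r ^+ n * dot x0 x0.
Proof.
move=> p0 nE.
have pn : (p < n)%N by rewrite nE addn1 ltnS mul2n -addnn leq_addr.
have p1n : (p.+1 < n)%N by rewrite nE addn1 ltnS mul2n -addnn -addn1 leq_add2l.
have pn1 : (p.-1 < n)%N by apply: leq_ltn_trans pn; exact: leq_pred.
have jmp : (p.-1 <= p < n)%N by rewrite leq_pred.
have jmp2 : (p.-1 <= p.+1 < n)%N by rewrite p1n andbT ltnW// ltnS leq_pred.
have pn2 : (2 * p <= n)%N by rewrite nE leq_addr.
have n2k : (n - 2 * p.-1 = 3)%N by rewrite nE addnC -addnBA ?leq_mul2l ?leq_pred// -mulnBr -subn1 subKn.
have n2kp k : (k < p)%N -> (2 * (p - k) + 1 = n - 2 * k)%N.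
  by move=> kp; rewrite nE addnC mulnBr addnBA ?leq_mul2l ?orTb ?(ltnW kp)// addnC.
have n2p : (n - 2 * p = 1)%N by rewrite nE addnC addnK.
have r0' : 0 < r := r0; have r1' : r < 1 := r1; have h0' : 0 < 1 + r := h0.
have nR : n%:R = 2 * p%:R + 1 :> R by rewrite nE natrD natrM.
have pR : 1 <= p%:R :> R by rewrite ler1n.
have B : 2 * r <= (p%:R + 1) * (1 - r ^+ 2).
  have := root_quadratic_bound n0 r01 rn; rewrite nR; lra.
have sp : 1 <= (n%:R - p%:R) * (1 - r) + 2 * (1 - r).
  rewrite -(ler_pM2r h0) nR.
  have : 0 <= (1 - r) * (1 + 2 * r) by apply: mulr_ge0; lra.
  lra.
have up : weight r n p = r by rewrite /weight n2p.
have me : mass r n p <= p%:R.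
  rewrite /mass up ler_pdivrMr// nR.
  lra.
have rn' : r ^+ (2 * p + 1) * (1 + (2 * p + 1)%:R * (1 + r)) = 1 by rewrite -nE.
have dp k : (0 < k < p)%N -> 0 <= direct r n p k.
  case/andP=> k0 kp; apply: direct_ge0 => //.
  have := @odd_transport_pos R r p r01 rn' (p - k)%N; rewrite subn_gt0 kp leq_subr => /(_ isT).
  rewrite n2kp// /weight 2!natrD natrB 1?ltnW//.
  by rewrite nR; have -> : p%:R + 1%:R + (p%:R - k%:R) = 2 * p%:R + 1 - k%:R :> R by ring.
have kp : (p.-1 < p)%N by rewrite prednK.
have mk : p.-1%:R = p%:R - 1 :> R by rewrite -[in RHS](prednK p0) -natr1 addrK.
have pn' : (2 * p < n)%N \/ (2 * p = n)%N by left; rewrite nE addn1.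
have IH := first_part pn' kp sp me dp.
have RL : direct_rate r n p p.-1 * r <= weight r n p.-1 := @direct_rate_le R r n p r01 rn pn2 p0 sp me p.-1 kp.
have u1 : weight r n p.-1 = r ^+ 3 by rewrite /weight n2k.
have T1 : (p%:R - p.-1%:R) * (Z p.-1 - Z p) <=
    K p - K p.-1 + 2 * (1 + r) * (p%:R - p.-1%:R) * F p.-1 by exact: jump.
have T2 : (p.+1%:R - p.-1%:R) * (Z p.-1 - Z p.+1) <=
    K p.+1 - K p.-1 + 2 * (1 + r) * (p.+1%:R - p.-1%:R) * F p.-1 by exact: jump.
rewrite u1 in IH RL.
pose v : R := p%:R + 2.
have vE : n%:R - p.-1%:R = v by rewrite nR mk /v; ring.
have v1 : n%:R - p%:R = v - 1 by rewrite nR /v; ring.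
have v2 : n%:R - p.+1%:R = v - 2 by rewrite nR -natr1 /v; ring.
have K0 := KE pn1; rewrite vE in K0; have K1 := KE pn; rewrite v1 in K1.
have K2 := KE p1n; rewrite v2 in K2.
have mm : p%:R - p.-1%:R = 1 :> R by rewrite mk; ring.
have mm2 : p.+1%:R - p.-1%:R = 2 :> R by rewrite mk -natr1; ring.
rewrite mm !mul1r mulr1 in T1; rewrite mm2 in T2.
have v0 : 0 < v by rewrite /v addr_gt0// (lt_le_trans ltr01).
(* The multiplier of the jump from [p - 1] to [p + 1], chosen to cancel [Z p.+1]. Below, [bypE] is
   the cancellation of [Z p] and [cv] that of [Z p.-1]. *)
pose b := (y * (v - 2) - nu) / v.
have bv : b * v = y * (v - 2) - nu by rewrite /b divfK// lt0r_neq0.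
have h2 : (1 + r) ^+ 2 != 0 by rewrite expf_neq0.
have h2p : 0 < (1 + r) ^+ 2 by rewrite exprn_gt0.
have massk : mass r n p.-1 * (1 + r) = r ^+ 3 * (1 + v * (1 + r)) - 1.
  by rewrite /mass divfK// u1 vE.
have bypk : bypass r n p p.-1 * (1 + r) = v - 3 - mass r n p.-1.
  rewrite /bypass mk opprB addrCA subrr addr0 mulr1 divfK// /v; ring.
have bypE : bypass r n p p.-1 = (r - (r ^+ 2 - 2 * b)) * (v - 1) - (r ^+ 2 - 2 * b)
   - (y - nu) * (v - 1) - nu * (v - 2).
  apply: (mulIf h2).
  have -> : bypass r n p p.-1 * (1 + r) ^+ 2 = (v - 3) * (1 + r) - mass r n p.-1 * (1 + r).
    by rewrite expr2 mulrA bypk; ring.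
  rewrite massk.
  have -> : ((r - (r ^+ 2 - 2 * b)) * (v - 1) - (r ^+ 2 - 2 * b) - (y - nu) * (v - 1) - nu * (v - 2)) *
    (1 + r) ^+ 2 = ((r - r ^+ 2) * (v - 1) - r ^+ 2) * (1 + r) ^+ 2 + 2 * (b * v) * (1 + r) ^+ 2
    - (y * (1 + r)) * (1 + r) * (v - 1) + nu * (1 + r) ^+ 2 by ring.
  rewrite bv.
  have -> : 2 * (y * (v - 2) - nu) * (1 + r) ^+ 2 = 2 * ((y * (1 + r)) * (1 + r) * (v - 2) - nu * (1 + r) ^+ 2) by ring.
  rewrite yE nuE; ring.
have dirk : direct_rate r n p p.-1 * (v + 1) = direct r n p p.-1.
  by rewrite /direct_rate vE divfK// lt0r_neq0// addr_gt0.
have cv : (r ^+ 3 - direct_rate r n p p.-1 - r + (r ^+ 2 - 2 * b) + b) * v = direct_rate r n p p.-1 - r ^+ 2.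
  apply: (mulIf h2).
  have -> : (r ^+ 3 - direct_rate r n p p.-1 - r + (r ^+ 2 - 2 * b) + b) * v * (1 + r) ^+ 2 =
    ((r ^+ 3 - r + r ^+ 2) * v - (b * v)) * (1 + r) ^+ 2 - direct r n p p.-1 * (1 + r) ^+ 2
    + direct_rate r n p p.-1 * (1 + r) ^+ 2 by rewrite -dirk; ring.
  have -> : direct r n p p.-1 * (1 + r) ^+ 2 =
      mass r n p.-1 * (1 + r) * (1 + r) - ((v - 3) * (1 + r) - mass r n p.-1 * (1 + r)).
    by rewrite -mulrBl -bypk /direct; ring.
  rewrite bv massk.
  have -> : ((r ^+ 3 - r + r ^+ 2) * v - (y * (v - 2) - nu)) * (1 + r) ^+ 2 =
   (r ^+ 3 - r + r ^+ 2) * v * (1 + r) ^+ 2 - (y * (1 + r)) * (1 + r) * (v - 2) + nu * (1 + r) ^+ 2 by ring.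
  rewrite yE nuE; ring.
have u0E : weight r n 0 = r ^+ n by rewrite /weight muln0 subn0.
rewrite vE -dirk u0E bypE in IH.
have tt : Th p.-1 <= Th p by rewrite -[in leRHS](prednK p0) /Th Theta_le.
have tt2 : Th p <= Th p.+1 by rewrite /Th Theta_le.
have nu0 : 0 <= nu.
  have [] := @root_odd_bounds R r p r01 rn' p0 => Bp _.
  rewrite -(pmulr_lge0 _ h2p) nuE.
  have : 0 <= p%:R * (1 - r) ^+ 2 by rewrite mulr_ge0// sqr_ge0.
  move=> /le_trans/(_ Bp); rewrite pmulr_rge0// => Bp'; lra.
have y0 : 0 <= y by rewrite divr_ge0 ?subr_ge0// ltW.
have b0 : 0 <= b.
  rewrite -(pmulr_lge0 _ v0) bv -(pmulr_lge0 _ h2p).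
  have -> : (y * (v - 2) - nu) * (1 + r) ^+ 2 = y * (1 + r) * (1 + r) * (v - 2) - nu * (1 + r) ^+ 2 by ring.
  rewrite yE nuE /v; lra.
have by' : b <= y.
  rewrite -(ler_pM2r v0) bv -subr_ge0.
  have -> : y * v - (y * (v - 2) - nu) = 2 * y + nu by ring.
  by rewrite addr_ge0// mulr_ge0.
have al0 : 0 <= r ^+ 2 - 2 * b.
  rewrite -(pmulr_lge0 _ v0) -(pmulr_lge0 _ h2p).
  have -> : (r ^+ 2 - 2 * b) * v * (1 + r) ^+ 2 = r ^+ 2 * v * (1 + r) ^+ 2
    - 2 * (b * v * (1 + r) ^+ 2) by ring.
  rewrite bv.
  have -> : (y * (v - 2) - nu) * (1 + r) ^+ 2 = y * (1 + r) * (1 + r) * (v - 2) - nu * (1 + r) ^+ 2 by ring.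
  rewrite yE nuE /v; have [Bp _] := @root_odd_bounds R r p r01 rn' p0.
  exact: odd_rate_pos.
have c0 : r ^+ 3 - direct_rate r n p p.-1 - r + (r ^+ 2 - 2 * b) + b <= 0.
  rewrite -(pmulr_lle0 _ v0) cv subr_le0 -(ler_pM2r r0); apply: le_trans RL _; lra.
pose zj := z p; pose zm := z p.+1.
have v10 : 0 < v - 1 by rewrite -v1 subr_gt0 ltr_nat.
have v20 : 0 < v - 2 by rewrite -v2 subr_gt0 ltr_nat.
have nj : dot zj zj = (v - 1) * Z p by rewrite /Z v1 mulrC divfK// lt0r_neq0.
have nm : dot zm zm = (v - 2) * Z p.+1 by rewrite /Z v2 mulrC divfK// lt0r_neq0.
have LZ : 0 <= (v - 2) * Z p + (v - 1) * Z p.+1 - 2 * dot zj zm.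
  have := @dot_weighted R d (v - 1) (v - 2) zj zm v20.
  have -> : v - 1 - (v - 2) = 1 by ring.
  have vlt : v - 2 < v - 1 by rewrite ltrD2l ltrN2 ltr1n.
  move=> /(_ vlt); rewrite mul1r !dotE (dotC zm zj) nj nm.
  rewrite [_ * Z p]mulrC mulfK ?lt0r_neq0// [_ * Z p.+1]mulrC mulfK ?lt0r_neq0//.
  rewrite -subr_ge0 => H; apply: le_trans H _; rewrite le_eqVlt; apply/orP; left; apply/eqP; ring.
have Th0 : 0 <= r ^+ n * Th p by apply: mulr_ge0; [rewrite exprn_ge0// ltW | apply: Theta_ge0].
have := @odd_step_alg R r v (direct_rate r n p p.-1) b nu y (r ^+ n) (dot x0 x0) (Th p.-1) (Th p) (Th p.+1)
  (Z p.-1) (Z p) (Z p.+1) (dot zj zm) (e p.-1) (F p.-1) cv bv IH.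
rewrite /= -K0 -K1 -K2 -nj -nm => S.
have {}S := S (mulr_ge0 al0 _) (mulr_ge0 b0 _) (mulr_ge0 _ _) (mulr_ge0 _ _) (mulr_ge0 nu0 LZ).
have eS : e p = r ^+ 2 * e p.-1 + K p.-1 - K p - 2 * r * (1 + r) * F p.-1.
  by rewrite -[in LHS](prednK p0) /e (residual_energyS _ hz) prednK.
rewrite -eS in S.
have {}S : r * e p + y * (2 * (dot zj zm - dot zm zm) - (Th p.+1 - Th p)) +
    (y - nu) * (dot zj zj + dot zm zm - 2 * dot zj zm) <= r ^+ n * (dot x0 x0 - Th p).
  apply: S; rewrite ?subr_ge0// ?oppr_ge0//.
apply: le_trans (_ : _ <= r ^+ n * (dot x0 x0 - Th p)) _; last by rewrite mulrBr gerBl.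
apply: le_trans S; rewrite le_eqVlt; apply/orP; left; apply/eqP.
have gm : 2 * (dot zj zm - dot zm zm) - (Th p.+1 - Th p) = 2 * F p.+1 + 2 * r * F p - (step_sqnorm z p + residual_drop r g p).
  have zE : z p = z p.+1 + (r *: g p + g p.+1) by rewrite -hz addrC subrK.
  have -> : Th p.+1 = Th p + 2 * gap z g F p.+1 + 2 * r * gap z g F p by [].
  rewrite /gap /step_sqnorm /residual_drop hz /zj /zm zE !dotE.
  rewrite (dotC (g p.+1) (g p)); ring.
rewrite gm.
have -> : dot zj zj + dot zm zm - 2 * dot zj zm = step_sqnorm z p.
  by rewrite /step_sqnorm !dotE /zj /zm (dotC (z p.+1)); ring.
rewrite /middle_potential /e /residual_energy /G; ring.
Qed.
End FirstHalf.

Section SecondHalf.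
Variables (R : realFieldType) (d : nat) (r : R) (z g : nat -> 'rV[R]_d) (F : nat -> R).
Hypothesis hz : forall k, z k - z k.+1 = r *: g k + g k.+1.
Hypothesis hQ : forall i j, dot (g j) (z i - z j) <= F i - F j.
Hypothesis hA : forall j, F j <= dot (g j) (z j).
Hypothesis hF : forall j, 0 <= F j.
Hypothesis r01 : 0 < r < 1.
Variable n : nat.
Hypothesis rn : r ^+ n * (1 + n%:R * (1 + r)) = 1.
Hypothesis n0 : (0 < n)%N.

Let r0 : 0 < r. Proof. by case/andP: r01. Qed.
Let r1 : r < 1. Proof. by case/andP: r01. Qed.
Let h0 : 0 < 1 + r. Proof. by rewrite addr_gt0. Qed.
Let hN0 : 1 + r != 0. Proof. exact: lt0r_neq0. Qed.
Let rN0 : r != 0. Proof. exact: lt0r_neq0. Qed.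
Let G k := dot (g k) (g k).

Lemma second_half V i0 : (n <= 2 * i0)%N -> (i0 < n)%N ->
  (forall k, (i0 <= k <= n)%N -> 1 + k%:R * (1 + r) <= back_weight r n k * (1 + (n%:R - k%:R) * (1 + r))) ->
  0 <= Psi r n i0 ->
  0 <= V - back_weight r n i0 * G i0 - 2 * F i0 + Phi r n i0 * (tail_sqnorm z n i0 - 2 * (1 + r) * (F i0 - F n)) ->
  G n <= r ^+ n * V.
Proof.
move=> ni i0n tr P0 I.
have GS k : G k.+1 = r ^+ 2 * G k - residual_drop r g k by rewrite /residual_drop /G opprB addrC subrK.
have SS k : (k < n)%N -> tail_sqnorm z n k = step_sqnorm z k + tail_sqnorm z n k.+1 by move=> kn; rewrite /tail_sqnorm big_ltn.
have Sn : tail_sqnorm z n n = 0 by rewrite /tail_sqnorm big_geq.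
have := @second_part R r n r01 rn V F G (residual_drop r g) (step_sqnorm z) (tail_sqnorm z n) i0 ni i0n tr P0 GS SS Sn
  (forward_step hz hQ) (backward_step hz hQ r0) (fun k => @long_step R d r z g F hz hQ r0 n k) (hF n) I.
have -> : back_weight r n n = r ^- n by rewrite /back_weight mul2n -addnn addnK.
by rewrite mulrC ler_pdivrMr ?exprn_gt0// mulrC.
Qed.

(** At the midpoint [back_weight] is 1 and [Psi] vanishes, so the invariant starts as an equality
    with [V] the residual energy. *)
Lemma even_second m : n = (2 * m)%N -> G n <= r ^+ n * residual_energy g F m.
Proof.
move=> nE; have m0 : (0 < m)%N by move: n0; rewrite nE; case: m {nE}.
have nm : (n <= 2 * m)%N by rewrite nE.
have mn : (m < n)%N by rewrite nE mul2n -addnn -addn1 leq_add2l.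
have b1 : back_weight r n m = 1 by rewrite /back_weight nE subnn expr0 invr1.
have nR : n%:R = 2 * m%:R :> R by rewrite nE natrM.
have P0 : Psi r n m = 0 by rewrite /Psi b1 nR !subrr mul0r subr0 mul0r.
apply: (second_half nm mn) => //; last 2 first.
- by rewrite P0.
- by rewrite /Phi P0 mul0r mul0r addr0 b1 mul1r /residual_energy /G; lra.
move=> k /andP[mk kn].
have := @second_transport_le R r 0 m r01; rewrite /= addn0 -nE => /(_ rn).
rewrite !addn0 expr0 invr1 mul1r => /(_ (lexx _) (k - m)%N).
have km : (k - m <= m)%N by rewrite leq_subLR addnn -mul2n -nE.
rewrite km => /(_ isT); rewrite subnKC// addn0 natrB// natrB//.
have -> : (2 * (k - m) = 2 * k - n)%N by rewrite mulnBr nE.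
by rewrite nR opprB; have -> : m%:R + (m%:R - k%:R) = 2 * m%:R - k%:R :> R by ring.
Qed.

Let y : R := (1 - r) / (1 + r).
Let nu : R := 1 - 2 / (1 + r) ^+ 2.

(** The invariant starts at [p + 1]. There it follows from the forward, backward and long steps at
    [p], with multipliers 1, [y / r - Phi] and [Phi], when [V] is the middle potential. *)
Lemma odd_second p : (0 < p)%N -> n = (2 * p + 1)%N -> G n <= r ^+ n * middle_potential r z g F p.
Proof.
move=> p0 nE.
have r0' : 0 < r := r0; have r1' : r < 1 := r1; have h0' : 0 < 1 + r := h0.
have pn : (p < n)%N by rewrite nE addn1 ltnS mul2n -addnn leq_addr.
have p1n : (p.+1 < n)%N by rewrite nE addn1 ltnS mul2n -addnn -addn1 leq_add2l.
have np : (n <= 2 * p.+1)%N by rewrite nE mulnS addnC leq_add2r.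
have bE : back_weight r n p.+1 = r^-1.
  by rewrite /back_weight nE mulnS addnC subnDl.
have nR : n%:R = 2 * p%:R + 1 :> R by rewrite nE natrD natrM.
have pR : 1 <= p%:R :> R by rewrite ler1n.
have B : 2 * r <= (p%:R + 1) * (1 - r ^+ 2).
  have := root_quadratic_bound n0 r01 rn; rewrite nR; lra.
have h2 : (1 + r) ^+ 2 != 0 by rewrite expf_neq0.
have PsiE : Psi r n p.+1 = 1 - y / r - nu.
  rewrite /Psi bE nR -[p.+1%:R]natr1 /y /nu; field.
  by rewrite rN0 hN0.
have PhiE : Phi r n p.+1 * p%:R = 1 - y / r - nu.
  rewrite /Phi PsiE -[p.+1%:R]natr1 nR.
  have -> : 2 * p%:R + 1 - (p%:R + 1) = p%:R :> R by ring.
  by rewrite divfK// pnatr_eq0 -lt0n.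
have rn' : r ^+ (2 * p + 1) * (1 + (2 * p + 1)%:R * (1 + r)) = 1 by rewrite -nE.
have Psi0 : 0 <= Psi r n p.+1.
  have [Bp _] := @root_odd_bounds R r p r01 rn' p0.
  have : 0 <= p%:R * (1 - r) ^+ 2 by rewrite mulr_ge0// sqr_ge0.
  move=> /le_trans/(_ Bp); rewrite pmulr_rge0// => Bp'.
  have -> : Psi r n p.+1 = (r ^+ 2 + 2 * r - 1) / (r * (1 + r) ^+ 2).
    by rewrite PsiE /y /nu; field; rewrite rN0 hN0.
  by apply: divr_ge0 => //; rewrite mulr_ge0 ?sqr_ge0// ltW.
have Phi0 : 0 <= Phi r n p.+1 by rewrite /Phi divr_ge0// subr_ge0 ler_nat ltnW.
have X0 : 0 <= y / r - Phi r n p.+1.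
  rewrite subr_ge0 -(ler_pM2r (lt_le_trans ltr01 pR)) PhiE -subr_ge0.
  have -> : y / r * p%:R - (1 - y / r - nu) = ((p%:R + 1) * (1 - r ^+ 2) - 2 * r) / (r * (1 + r) ^+ 2).
    by rewrite /y /nu; field; rewrite rN0 hN0.
  by apply: divr_ge0; rewrite ?subr_ge0// mulr_ge0 ?sqr_ge0// ltW.
apply: (second_half np p1n) => //.
  move=> k /andP[pk kn].
  have := @second_transport_le R r 1 p r01; rewrite /= -nE => /(_ rn).
  have base : 1 + (p + 1)%:R * (1 + r) <= r ^- 1 * (1 + p%:R * (1 + r)).
    rewrite expr1 [leRHS]mulrC ler_pdivlMr// natrD; lra.
  move=> /(_ base (k - p.+1)%N).
  have km : (k - p.+1 <= p)%N by rewrite leq_subLR (leq_trans kn)// nE mul2n -addnn -addnA addn1 addnS.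
  rewrite km => /(_ isT); rewrite addn1 subnKC//.
  have -> : (2 * (k - p.+1) + 1 = 2 * k - n)%N.
    rewrite mulnBr nE; have : (2 * p.+1 <= 2 * k)%N by rewrite leq_mul2l pk orbT.
    by clear; rewrite mulnS; move: (2 * k)%N (2 * p)%N => a b; lia.
  rewrite natrB// natrB// -[p.+1%:R]natr1 nR /back_weight.
  by have -> : p%:R - (k%:R - (p%:R + 1)) = 2 * p%:R + 1 - k%:R :> R by ring.
have A := forward_step hz hQ p; have Bw := backward_step hz hQ r0 p.
have C := @long_step R d r z g F hz hQ r0 n p pn.
rewrite -subr_ge0 in A; rewrite -subr_ge0 in Bw; rewrite -subr_ge0 in C.
have := addr_ge0 (addr_ge0 A (mulr_ge0 X0 Bw)) (mulr_ge0 Phi0 C).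
move=> H; apply: le_trans H _; rewrite le_eqVlt; apply/orP; left; apply/eqP.
have SE : tail_sqnorm z n p = step_sqnorm z p + tail_sqnorm z n p.+1 by rewrite /tail_sqnorm big_ltn.
have GE : G p.+1 = r ^+ 2 * G p - residual_drop r g p by rewrite /residual_drop /G opprB addrC subrK.
have -> : Phi r n p.+1 * ((n%:R - 1 - p%:R) * step_sqnorm z p + tail_sqnorm z n p + residual_drop r g p -
     2 * (r * F p + F p.+1 - (1 + r) * F n)) = (1 - y / r - nu) * step_sqnorm z p +
   Phi r n p.+1 * (step_sqnorm z p + tail_sqnorm z n p.+1 + residual_drop r g p - 2 * (r * F p + F p.+1 - (1 + r) * F n)).
  by rewrite -PhiE SE nR; ring.
rewrite bE GE /middle_potential -/y -/nu -/(G p) /y; field.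
by rewrite rN0 hN0.
Qed.

(** No index precedes the midpoint here, so the inequalities between the indices 0, 1 and the
    minimizer are combined directly. They add up to the claim modulo [r^2 + 2 r = 1], the equation
    of [r] for [n = 1]. *)
Lemma residual_bound_one : n = 1%N -> G 1%N <= r ^+ 2 * dot (z 0%N + g 0%N) (z 0%N + g 0%N).
Proof.
move=> n1; have rE : 1 - 2 * r - r ^+ 2 = 0.
  by move: rn; rewrite n1 expr1 mul1r => H; lra.
have r0' : 0 < r := r0; have r1' : r < 1 := r1; have h0' : 0 < 1 + r := h0.
have Q1 := hQ 0 1; have Q2 := hQ 1 0; have A0 := hA 0; have A1 := hA 1; have F1 := hF 1.
have zz := dot_ge0 (z 1%N).
rewrite -subr_ge0 in Q1; rewrite -subr_ge0 in Q2; rewrite -subr_ge0 in A0; rewrite -subr_ge0 in A1.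
have r20 : 0 <= 2 * r ^+ 2 by rewrite mulr_ge0 ?sqr_ge0.
have r10 : 0 <= 2 * r by rewrite mulr_ge0// ltW.
have := addr_ge0 (addr_ge0 (mulr_ge0 r10 Q1) (mulr_ge0 r20 Q2))
  (addr_ge0 (mulr_ge0 (mulr_ge0 r20 (ltW h0)) A0) (mulr_ge0 r20 A1)).
have := addr_ge0 (mulr_ge0 r10 F1) (mulr_ge0 (sqr_ge0 r) zz).
have zE : z 0%N = z 1%N + (r *: g 0%N + g 1%N) by rewrite -hz addrC subrK.
rewrite /G -(opprB (z 0%N) (z 1%N)) hz zE !dotE.
rewrite (dotC (g 1%N) (g 0%N)) (dotC (z 1%N) (g 0%N)) (dotC (z 1%N) (g 1%N)).
move: (dot (g 0%N) (g 0%N)) (dot (g 0%N) (g 1%N)) (dot (g 1%N) (g 1%N)) (dot (g 0%N) (z 1%N))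
  (dot (g 1%N) (z 1%N)) (dot (z 1%N) (z 1%N)) (F 0%N) (F 1%N) => a b c e f q u v H1 H2.
rewrite -subr_ge0; apply: le_trans (addr_ge0 H1 H2) _; rewrite le_eqVlt; apply/orP; left; apply/eqP.
set lhs := (X in X = _); set rhs := (X in _ = X).
have -> : lhs = rhs - (1 - 2 * r - r ^+ 2) * (r ^+ 2 * a - c - 2 * r * u).
  by rewrite /lhs /rhs; ring.
by rewrite rE mul0r subr0.
Qed.

Lemma residual_bound : G n <= (r ^+ n) ^+ 2 * dot (z 0%N + g 0%N) (z 0%N + g 0%N).
Proof.
have rn0 : 0 <= r ^+ n by rewrite exprn_ge0// ltW.
rewrite expr2 -mulrA.
have [[m nE]|[p nE]] : (exists m, n = (2 * m)%N) \/ exists p, n = (2 * p + 1)%N.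
  have := odd_double_half n; case: (odd n) => /= nE; [right|left]; exists n./2.
    by rewrite mul2n addnC.
  by rewrite mul2n.
- have m0 : (0 < m)%N by move: n0; rewrite nE; case: m {nE}.
  apply: le_trans (even_second nE) _; rewrite ler_wpM2l//.
  exact: (even_first hz hQ hA r01 rn n0 m0 nE).
- case: p nE => [|p] nE.
    by rewrite mulrA -expr2 nE expr1; apply: residual_bound_one.
  apply: le_trans (odd_second (ltn0Sn _) nE) _; rewrite ler_wpM2l//.
  exact: (odd_first hz hQ hA r01 rn n0 (ltn0Sn p) nE).
Qed.
End SecondHalf.

(** * Smooth convex functions and gradient descent *)

Section SmoothConvex.
Variables (R : realType) (d : nat).
Implicit Types (x y u v : 'rV[R]_d.+1).

Lemma enorm_sqr (m : nat) (x : 'rV[R]_m) : enorm x ^+ 2 = dot x x.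
Proof.
rewrite /enorm sqr_sqrtr; last by apply: sumr_ge0 => i _; rewrite sqr_ge0.
by apply: eq_bigr => i _; rewrite expr2.
Qed.

Lemma enorm_ge0 (m : nat) (x : 'rV[R]_m) : 0 <= enorm x.
Proof. exact: sqrtr_ge0. Qed.

Lemma enormE (m : nat) (x : 'rV[R]_m) : enorm x = Num.sqrt (dot x x).
Proof. by rewrite -enorm_sqr sqrtr_sqr ger0_norm// enorm_ge0. Qed.

Lemma enormZ (m : nat) (c : R) (x : 'rV[R]_m) : enorm (c *: x) = `|c| * enorm x.
Proof. by rewrite !enormE dotZl dotZr mulrA -expr2 sqrtrM ?sqr_ge0// sqrtr_sqr. Qed.

Lemma cauchy_schwarz (m : nat) (x y : 'rV[R]_m) : dot x y <= enorm x * enorm y.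
Proof.
have [x0 y0] := (enorm_ge0 x, enorm_ge0 y).
have := dot_ge0 (enorm y *: x - enorm x *: y).
rewrite !dotE (dotC y x) -!enorm_sqr => H.
have [xy0|xy0] := leP (enorm x * enorm y) 0.
  have xy : enorm x * enorm y = 0 by apply/eqP; rewrite eq_le xy0 mulr_ge0.
  rewrite xy.
  have zero (w w' : 'rV[R]_m) : enorm w = 0 -> dot w w' = 0.
    move=> w0; have : dot w w = 0 by rewrite -enorm_sqr w0 expr0n.
    rewrite /dot => /eqP; rewrite psumr_eq0 => [/allP H'|i _]; last by rewrite -expr2 sqr_ge0.
    apply: big1 => i _; have := H' i; rewrite mem_index_enum => /(_ isT) /=.
    by rewrite mulf_eq0 orbb => /eqP ->; rewrite mul0r.
  by move/eqP: xy; rewrite mulf_eq0 => /orP[]/eqP /zero; [move=> ->|rewrite dotC => ->].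
rewrite -(ler_pM2l xy0); lra.
Qed.

Lemma dot_le0 (m : nat) (x : 'rV[R]_m) : dot x x <= 0 -> x = 0.
Proof.
move=> x0; have : dot x x = 0 by apply/eqP; rewrite eq_le x0 dot_ge0.
rewrite /dot => /eqP; rewrite psumr_eq0 => [/allP H|i _]; last by rewrite -expr2 sqr_ge0.
apply/rowP => i; rewrite mxE; have := H i; rewrite mem_index_enum => /(_ isT) /=.
by rewrite mulf_eq0 orbb => /eqP.
Qed.

(** Takes the place of a limit [t -> 0] in the first-order arguments for gradients and for proximal
    points. *)
Lemma ge0_of_small_perturbation (a c : R) : 0 <= c ->
  (forall t, 0 < t <= 1 -> 0 <= a + c * t) -> 0 <= a.
Proof.
move=> c0 H; rewrite leNgt; apply/negP => a0.
have c1 : 0 < c + 1 - a by lra.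
have := H (- a / (c + 1 - a)).
rewrite divr_gt0 ?oppr_gt0//= ler_pdivrMr// mul1r.
have -> : - a <= c + 1 - a by lra.
move=> /(_ isT); apply/negP; rewrite -ltNge -(pmulr_rlt0 _ c1).
have -> : (c + 1 - a) * (a + c * (- a / (c + 1 - a))) = a * (1 - a).
  by field; rewrite gt_eqF.
by rewrite nmulr_rlt0//; lra.
Qed.

Variable f : 'rV[R]_d.+1 -> R.

Lemma derive_dot x v : differentiable f x -> 'D_v f x = dot (grad f x) v.
Proof.
move=> df; rewrite deriveE// [in LHS](row_sum_delta v) linear_sum /dot.
by apply: eq_bigr => i _; rewrite linearZ /= mxE deriveE// mulrC.
Qed.

Lemma is_derive_line y u (t : R) : differentiable f (y + t *: u) ->
  is_derive t 1 (fun s : R => f (y + s *: u)) (dot (grad f (y + t *: u)) u).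
Proof.
move=> df; rewrite -derive_dot//.
have E : (fun h : R => h^-1 *: (((fun s : R => f (y + s *: u)) \o shift t) (h *: 1) - f (y + t *: u)))
  = (fun h : R => h^-1 *: ((f \o shift (y + t *: u)) (h *: u) - f (y + t *: u))).
  apply/funext => h /=; congr (_ *: (f _ - _)).
  by rewrite [h%:A]mulr1 scalerDl addrCA.
by apply: DeriveDef; rewrite /derivable /derive E//; exact: diff_derivable.
Qed.

Hypothesis df : forall x, differentiable f x.

Section Descent.
Variable L : R.
Hypothesis L0 : 0 < L.
Hypothesis lip : forall x y, enorm (grad f x - grad f y) <= L * enorm (x - y).

(** [phi] is [f] along the segment minus the quadratic model without its constant term. Its
    derivative is nonpositive on the open unit interval by Cauchy-Schwarz and the Lipschitz bound,
    and the mean value theorem concludes. *)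
Lemma descent x y : f x <= f y + dot (grad f y) (x - y) + L / 2 * dot (x - y) (x - y).
Proof.
set u := x - y.
pose phi (t : R) := f (y + t *: u) - (t * dot (grad f y) u + t ^+ 2 * (L / 2 * dot u u)).
pose dphi (t : R) := dot (grad f (y + t *: u)) u - (dot (grad f y) u + 2 * t * (L / 2 * dot u u)).
have phiD (t : R) : is_derive t 1 phi (dphi t).
  have H1 := is_derive_line (df (y + t *: u)).
  pose p : {poly R} := (dot (grad f y) u) *: 'X + (L / 2 * dot u u) *: 'X ^+ 2.
  have -> : phi = (fun s : R => f (y + s *: u)) - horner p.
    by apply/funext => s; rewrite /phi -[RHS]/(f (y + s *: u) - p.[s]) /p hornerD !hornerZ hornerX hornerXn; congr (_ - _); ring.
  have -> : dphi t = dot (grad f (y + t *: u)) u - (horner p)^`()%classic t.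
    rewrite /dphi -derive.derivE /p derivD !derivZ derivX derivXn hornerD !hornerZ hornerMn hornerX hornerC; congr (_ - _); ring.
  apply: is_deriveB; rewrite derive1E; apply: derivableP; exact: derivable_horner.
have [] := @MVT R phi dphi 0 1 ltr01 (fun s _ => phiD s).
  by apply: derivable_within_continuous => t _; apply: ex_derive.
move=> c; rewrite in_itv /= => /andP[c0 c1].
rewrite subr0 mulr1 {1}/phi scale1r addrCA subrr addr0 expr1n !mul1r /phi scale0r addr0 mul0r expr0n mul0r addr0 subr0.
have : dphi c <= 0.
  rewrite /dphi.
  have := cauchy_schwarz (grad f (y + c *: u) - grad f y) u.
  rewrite dotBl => H.
  have := lip (y + c *: u) y; rewrite addrAC subrr add0r => H'.
  have cu : enorm (c *: u) = c * enorm u.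
    by rewrite enormZ gtr0_norm.
  have := ler_wpM2r (enorm_ge0 u) H'; rewrite cu -enorm_sqr; lra.
lra.
Qed.

Hypothesis cf : convex_function setT f.

Lemma convex_le x y (t : R) : 0 <= t <= 1 ->
  f (t *: x + (1 - t) *: y) <= t * f x + (1 - t) * f y.
Proof.
case/andP => t0 t1.
exact: (cf (Itv01 t0 t1) (in_setT x) (in_setT y)).
Qed.

(** Convexity at [y + t u], the descent inequality from there back to [y], and the Lipschitz bound
    between the two gradients give the claim up to an error of order [t]. *)
Lemma gradient_le x y : f y + dot (grad f y) (x - y) <= f x.
Proof.
set u := x - y.
suff H : forall t, 0 < t <= 1 -> 0 <= f x - f y - dot (grad f y) u + 3 / 2 * L * dot u u * t.
  have c0 : 0 <= 3 / 2 * L * dot u u.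
    by apply: mulr_ge0 (dot_ge0 _); apply: mulr_ge0; [lra|exact: ltW].
  by have := ge0_of_small_perturbation c0 H; lra.
move=> t /andP[t0 t1].
have C := @convex_le x y t; rewrite (ltW t0) t1 in C; have {}C := C isT.
have xE : t *: x + (1 - t) *: y = y + t *: u.
  by rewrite /u scalerBl scale1r scalerBr addrCA.
have D := descent y (y + t *: u); rewrite xE in C.
have yE : y - (y + t *: u) = - (t *: u) by rewrite opprD addrA subrr add0r.
rewrite yE in D.
have E1 : dot (grad f (y + t *: u)) (- (t *: u)) = - (t * dot (grad f (y + t *: u)) u).
  by rewrite dotNr dotZr.
have E2 : dot (- (t *: u)) (- (t *: u)) = t ^+ 2 * dot u u.
  by rewrite dotNl dotNr opprK dotZl dotZr mulrA.
rewrite E1 E2 in D.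
have tu : enorm (t *: u) = t * enorm u.
  by rewrite enormZ gtr0_norm.
have CS := cauchy_schwarz (grad f y - grad f (y + t *: u)) u; rewrite dotBl in CS.
have := lip y (y + t *: u); rewrite yE => H'.
have tu' : enorm (- (t *: u)) = t * enorm u by rewrite -tu !enormE dotNl dotNr opprK.
rewrite tu' in H'.
have := ler_wpM2r (enorm_ge0 u) H'; rewrite -[L * _ * enorm u]mulrA -[t * _ * _]mulrA -expr2 enorm_sqr => H''.
have G : dot (grad f y) u - dot (grad f (y + t *: u)) u <= L * (t * dot u u) by lra.
have := ler_wpM2l (ltW t0) G => {}G.
rewrite -(pmulr_rge0 _ t0); lra.
Qed.

(* Both sides are compared at w = x - (grad f x - grad f y) / L: the gradient inequality
   at y bounds f w from below, the descent inequality at x from above. *)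
Lemma interpolation x y : f y + dot (grad f y) (x - y)
  + (2 * L)^-1 * dot (grad f x - grad f y) (grad f x - grad f y) <= f x.
Proof.
set e := grad f x - grad f y.
have H1 := gradient_le (x - L^-1 *: e) y.
have H2 := descent (x - L^-1 *: e) x.
have E1 : x - L^-1 *: e - x = - (L^-1 *: e) by rewrite addrAC subrr add0r.
have E2 : x - L^-1 *: e - y = (x - y) - L^-1 *: e by rewrite addrAC.
rewrite E1 in H2; rewrite E2 in H1.
have := le_trans H1 H2.
rewrite dotBr !dotNr !dotNl !dotZr !dotZl.
have e2 : dot e e = dot (grad f x) e - dot (grad f y) e by rewrite -dotBl.
have -> : L / 2 * - - (L^-1 * (L^-1 * dot e e)) = (2 * L)^-1 * dot e e.
  by field; rewrite gt_eqF.
have -> : dot (grad f y) e = dot (grad f x) e - dot e e by rewrite e2; ring.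
have -> : L^-1 * (dot (grad f x) e - dot e e) = L^-1 * dot (grad f x) e - 2 * ((2 * L)^-1 * dot e e).
  by field; rewrite gt_eqF.
lra.
Qed.

(** A gradient step of length [1 / L] from [xs] would lower [f] by at least
    [|grad f xs|^2 / (2 L)]. *)
Lemma grad_argmin xs : argmin setT f xs -> grad f xs = 0.
Proof.
move=> [_ fmin]; have := descent (xs - L^-1 *: grad f xs) xs.
have -> : xs - L^-1 *: grad f xs - xs = - (L^-1 *: grad f xs) by rewrite addrAC subrr add0r.
rewrite !dotNr dotNl dotZl !dotZr opprK => H.
have := le_trans (fmin _ I) H => {}H.
have H2 : dot (grad f xs) (grad f xs) <= 0.
  have : 0 < (2 * L)^-1 by rewrite invr_gt0 mulr_gt0.
  move=> /pmulr_rle0 <-.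
  have : L / 2 * (L^-1 * (L^-1 * dot (grad f xs) (grad f xs))) = (2 * L)^-1 * dot (grad f xs) (grad f xs).
    by field; rewrite gt_eqF.
  have : L^-1 * dot (grad f xs) (grad f xs) = 2 * ((2 * L)^-1 * dot (grad f xs) (grad f xs)).
    by field; rewrite gt_eqF.
  lra.
exact: dot_le0.
Qed.
End Descent.
End SmoothConvex.

Section GradientDescent.
Variables (R : realType) (d n : nat).
Hypothesis n0 : (0 < n)%N.
Let r : R := r_cst R n.
Let h : R := h_cst R n.

Lemma enorm_le (m : nat) (c : R) (x y : 'rV[R]_m) : 0 <= c ->
  dot x x <= c ^+ 2 * dot y y -> enorm x <= c * enorm y.
Proof.
move=> c0 H; rewrite !enormE -[c]ger0_norm// -sqrtr_sqr -sqrtrM ?sqr_ge0//.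
exact: ler_wsqrtr.
Qed.

Lemma gd_bound (L : R) (f : 'rV[R]_d.+1 -> R) (x0 xs : 'rV[R]_d.+1) : 0 < L ->
  convex_function setT f -> smooth L f -> argmin setT f xs ->
  enorm (grad f (gd L h f x0 n)) <= eta_cst R n * (L * enorm (x0 - xs)).
Proof.
move=> L0 cf [df lip] mxs.
have [r01 rn] := r_cstP R n0; rewrite -/r in r01 rn.
have r0 : 0 <= r ^+ n by rewrite exprn_ge0//; case/andP: r01 => /ltW.
pose x k := gd L h f x0 k.
pose g k := L^-1 *: grad f (x k).
(* Shifting [z k] by [g k] and [F k] by [|g_k|^2 / 2] absorbs the quadratic term of the
   interpolation inequality, so that [hQ] takes the form of a subgradient inequality. *)
pose z k := x k - xs - g k.
pose F k := L^-1 * (f (x k) - f xs) - dot (g k) (g k) / 2.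
have LN0 : L != 0 by rewrite gt_eqF.
have Li : 0 < L^-1 by rewrite invr_gt0.
have xS k : x k.+1 = x k - h *: g k by rewrite /x /= -/(x k) /g scalerA.
have gE k : grad f (x k) = L *: g k by rewrite /g scalerA divff// scale1r.
have gs := grad_argmin df L0 lip mxs.
have interp := interpolation df L0 lip cf.
have P u v : dot (L^-1 *: grad f v) (u - v)
   + dot (L^-1 *: grad f u - L^-1 *: grad f v) (L^-1 *: grad f u - L^-1 *: grad f v) / 2
   <= L^-1 * (f u - f v).
  rewrite -scalerBr !dotZl !dotZr -(ler_pM2l L0) mulVKf// lerBrDl.
  apply: le_trans (interp u v); rewrite le_eqVlt; apply/orP; left; apply/eqP.
  by field.
have hz k : z k - z k.+1 = r *: g k + g k.+1.
  rewrite /z xS /h /h_cst -/r scalerDl scale1r.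
  by apply/rowP => i; rewrite !mxE; ring.
have hQ i j : dot (g j) (z i - z j) <= F i - F j.
  have := P (x i) (x j); rewrite -/(g i) -/(g j).
  have -> : z i - z j = (x i - x j) - (g i - g j).
    by rewrite /z; apply/rowP => k; rewrite !mxE; ring.
  rewrite /F; move: (g i) (g j) (x i - x j) => a b u; rewrite !dotE (dotC b a); lra.
have hA j : F j <= dot (g j) (z j).
  have := P xs (x j); rewrite gs scaler0 sub0r dotNl dotNr opprK -/(g j) => H.
  rewrite /z /F dotBr -(opprB xs) dotNr; lra.
have hF j : 0 <= F j.
  have := P (x j) xs; rewrite gs scaler0 subr0 dot0l add0r -/(g j) /F; lra.
have := residual_bound hz hQ hA hF r01 rn n0.
have -> : z 0%N + g 0%N = x0 - xs by rewrite /z subrK.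
move=> H; rewrite -/(x n) gE.
have -> : enorm (L *: g n) = L * enorm (g n).
  by rewrite enormZ gtr0_norm.
by rewrite mulrCA ler_pM2l//; apply: enorm_le.
Qed.
End GradientDescent.

(** * Proximal points and the relaxed proximal point method *)

Lemma seq_has_min (R : realType) (s : seq R) : s != [::] ->
  exists2 m, m \in s & forall x, x \in s -> m <= x.
Proof.
elim: s => [//|a s IH] _; have [->|s0] := eqVneq s [::].
  by exists a; rewrite ?mem_head// => x; rewrite inE => /eqP ->.
have [m ms mle] := IH s0; have [am|ma] := leP a m.
  exists a; rewrite ?mem_head// => x; rewrite inE => /orP[/eqP ->//|/mle].
  exact: le_trans.
exists m; first by rewrite inE ms orbT.
by move=> x; rewrite inE => /orP[/eqP ->|/mle//]; exact: ltW.
Qed.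

Lemma ereal_real_between (R : realFieldType) (x y : \bar R) : (x < y)%E ->
  exists2 a : R, (x < a%:E)%E & (a%:E < y)%E.
Proof.
case: x y => [x| |] [y| |]//= xy.
- by exists ((x + y) / 2); rewrite lte_fin; move: xy; rewrite lte_fin; lra.
- by exists (x + 1); rewrite ?ltry// lte_fin; lra.
- by exists (y - 1); rewrite ?ltNyr// lte_fin; lra.
- by exists 0; rewrite ?ltNyr ?ltry.
Qed.

(** Without a minimum, every value on [B] exceeds a real [a] that itself exceeds another value, so
    the open sets [f > a] for such [a] cover [B]. In a finite subcover, a point with value below the
    least [a] is not covered. *)
Lemma lsc_compact_min (R : realType) (T : ptopologicalType) (f : T -> \bar R) (B : set T) :
  (forall a : R, open [set x | (a%:E < f x)%E]) -> compact B -> B !=set0 ->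
  exists2 c, B c & forall x, B x -> (f c <= f x)%E.
Proof.
move=> fo; rewrite compact_cover => Bc [b Bb].
apply: contrapT => /forall2NP nomin.
have lower x : B x -> exists2 a : R, (exists2 w, B w & (f w < a%:E)%E) & (a%:E < f x)%E.
  move=> Bx; have [//|/existsNP[w /not_implyP[Bw /negP]]] := nomin x.
  rewrite -ltNge => fwx.
  by have [a wa ax] := ereal_real_between fwx; exists a => //; exists w.
pose D := [set a : R | exists2 w, B w & (f w < a%:E)%E].
have [] := Bc R D (fun a => [set x | (a%:E < f x)%E]).
- by move=> a _; exact: fo.
- by move=> x /lower[a Da ax]; exists a.
move=> D' D'D cov.
have [m mD' mle] : exists2 m, m \in (D' : seq R) & forall x, x \in (D' : seq R) -> m <= x.
  apply: seq_has_min; apply/eqP => D'0.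
  have [a /=] := cov _ Bb; rewrite -[a \in D']/(a \in (D' : seq R)) D'0 //.
have := D'D _ mD'; rewrite inE => -[w Bw fwm].
have [a /= aD' afw] := cov _ Bw.
have := lt_trans afw fwm; rewrite lte_fin; apply/negP; rewrite -leNgt.
exact: mle.
Qed.

Section ProximalPoint.
Variables (R : realType) (d : nat) (lambda : R) (F : 'rV[R]_d.+1 -> \bar R) (xs : 'rV[R]_d.+1).
Hypothesis l0 : 0 < lambda.
Hypothesis Fproper : Defs.proper F.
Hypothesis Flsc : lower_semicontinuous F.
Hypothesis Fconv : econvex F.
Hypothesis Fmin : argmin setT F xs.

Let phi (x z : 'rV[R]_d.+1) : \bar R := (F z + ((2 * lambda)^-1 * enorm (z - x) ^+ 2)%R%:E)%E.

Lemma sqdist_continuous (x : 'rV[R]_d.+1) : continuous (fun z : 'rV[R]_d.+1 => enorm (z - x) ^+ 2).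
Proof.
have -> : (fun z : 'rV[R]_d.+1 => enorm (z - x) ^+ 2) =
    (fun z : 'rV[R]_d.+1 => \sum_(i < d.+1) (z 0 i - x 0 i) ^+ 2).
  apply/funext => z; rewrite enorm_sqr; apply: eq_bigr => i _.
  by rewrite !mxE expr2.
apply: continuous_big => [|i _ z]; first exact: add_continuous.
rewrite /continuous_at; under eq_fun do rewrite expr2.
rewrite expr2; have C : (fun z0 : 'rV[R]_d.+1 => z0 0 i - x 0 i) @ z --> z 0 i - x 0 i.
  have C0 : (fun M : 'rV[R]_d.+1 => M 0 i) @ z --> z 0 i := @coord_continuous R 1 d.+1 0 i z.
  exact: cvgB C0 (cvg_cst _).
exact: (cvgM C C).
Qed.

Let Fs : exists c : R, F xs = c%:E.
Proof.
have [FN [x1 Fx1]] := Fproper; have [_ /(_ x1 I)] := Fmin.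
have := FN xs; case: (F xs) => [c| |]//; first by exists c.
by move=> _; rewrite leye_eq => /eqP Fx; move: Fx1; rewrite Fx.
Qed.

Lemma phi_open x (a : R) : open [set z | (a%:E < phi x z)%E].
Proof.
rewrite openE => z /= az.
(* Splits the strict inequality between the two summands, so that semicontinuity of [F] and
   continuity of the quadratic term apply separately. *)
have [b bF aq] : exists2 b : R, (b%:E < F z)%E & a - b < (2 * lambda)^-1 * enorm (z - x) ^+ 2.
  have [FN _] := Fproper; move: az (FN z); rewrite /phi; case: (F z) => [c| |]// az _.
    move: az; rewrite -EFinD lte_fin => az.
    set q := _ * _ in az *.
    by exists ((a - q + c) / 2); rewrite ?lte_fin; lra.
  exists (a - (2 * lambda)^-1 * enorm (z - x) ^+ 2 + 1); first exact: ltry.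
  set q := _ * _; lra.
have [V Vz VF] := Flsc bF.
have C : (fun w : 'rV[R]_d.+1 => (2 * lambda)^-1 * enorm (w - x) ^+ 2) @ z -->
    (2 * lambda)^-1 * enorm (z - x) ^+ 2.
  exact: (cvgM (cvg_cst ((2 * lambda)^-1)) (@sqdist_continuous x z)).
have N := cvgr_gt _ C _ aq.
near=> w.
rewrite /= /phi; have Vw : V w by near: w; exact: Vz.
have qw : a - b < (2 * lambda)^-1 * enorm (w - x) ^+ 2 by near: w; exact: N.
have := VF _ Vw; case: (F w) => [c| |]//; last first.
  by move=> _; rewrite addye// ltry.
by rewrite !lte_fin => bc; lra.
Unshelve. all: by end_near.
Qed.

Lemma coord_le_enorm (z : 'rV[R]_d.+1) i : `|z 0 i| <= enorm z.
Proof.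
rewrite -sqrtr_sqr /enorm; apply: ler_wsqrtr.
by rewrite (bigD1 i)//= lerDl sumr_ge0// => j _; rewrite sqr_ge0.
Qed.

(** Outside the cube [B] around [x] with half side [|xs - x|] the quadratic term exceeds its value
    at [xs], and [F] is nowhere below [F xs]. The minimizer of [F] thus confines the search to a
    compact set. *)
Lemma prox_argmin x : argmin setT (phi x) (prox lambda F x).
Proof.
apply: xgetPex.
pose rho := enorm (xs - x).
pose B := [set v : 'rV[R]_d.+1 | forall i, `[x 0 i - rho, x 0 i + rho]%classic (v ord0 i)].
have Bc : compact B.
  apply: (@rV_compact _ _ (fun i => `[x 0 i - rho, x 0 i + rho]%classic)).
  by move=> i; exact: segment_compact.
have Bxs : B xs.
  move=> i /=; rewrite in_itv /=.
  have := coord_le_enorm (xs - x) i; rewrite !mxE ler_norml -/rho; lra.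
have [c Bc' cmin] := lsc_compact_min (@phi_open x) Bc (ex_intro _ xs Bxs).
exists c; split => // z _.
have [|nB] := pselect (B z); first exact: cmin.
apply: le_trans (cmin _ Bxs) _.
have [_ Fm] := Fmin; apply: leeD; first exact: Fm.
rewrite lee_fin; apply: ler_wpM2l; first by rewrite invr_ge0 mulr_ge0// ltW.
rewrite lerXn2r ?nnegrE ?enorm_ge0//.
move: nB => /existsNP[i /=]; rewrite in_itv /= => /negP out.
rewrite -/rho leNgt; apply/negP => zr; move: out; apply/negP; rewrite negbK.
have := coord_le_enorm (z - x) i; rewrite !mxE ler_norml; lra.
Qed.

(** The second part says that [(x - p) / lambda] is a subgradient of [F] at the proximal point [p].
    It comes from comparing [p] with [p + t (w - p)], using convexity of [F] and dividing by [t]. *)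
Lemma prox_fin x : exists2 c : R, F (prox lambda F x) = c%:E &
  forall w, ((c + lambda^-1 * dot (x - prox lambda F x) (w - prox lambda F x))%:E <= F w)%E.
Proof.
have [_ pmin] := prox_argmin x; set p := prox lambda F x in pmin *.
have [FN _] := Fproper; have [cs Fcs] := Fs.
have [c Fc] : exists c : R, F p = c%:E.
  have := pmin xs I; rewrite /phi Fcs -EFinD; have := FN p.
  by case: (F p) => [c| |]//; exists c.
exists c => // w.
have := FN w; case Fw : (F w) => [v| |]// _; last by rewrite leey.
rewrite lee_fin -subr_ge0.
set u := w - p.
have c0 : 0 <= (2 * lambda)^-1 * dot u u by rewrite mulr_ge0 ?dot_ge0// invr_ge0 mulr_ge0// ltW.
apply: (ge0_of_small_perturbation c0) => t /andP[t0 t1].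
have C : (F (t *: w + (1 - t) *: p) <= t%:E * F w + (1 - t)%:E * F p)%E by apply: Fconv; rewrite (ltW t0).
rewrite Fw Fc -!EFinM -EFinD in C.
have := pmin (t *: w + (1 - t) *: p) I.
have E : t *: w + (1 - t) *: p = p + t *: u by rewrite /u scalerBl scale1r scalerBr addrCA.
rewrite E in C *; rewrite /phi Fc => P.
have {P C} := le_trans P (leeD2r _ C).
rewrite -!EFinD lee_fin.
have -> : p + t *: u - x = (p - x) + t *: u by rewrite addrAC.
have Q (a b : 'rV[R]_d.+1) : dot (a + t *: b) (a + t *: b) = dot a a + 2 * t * dot a b + t ^+ 2 * dot b b.
  by rewrite !dotE (dotC b a); ring.
rewrite !enorm_sqr Q => H.
rewrite -(opprB p x) dotNl -(pmulr_rge0 _ t0).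
have l2 : lambda^-1 = 2 * (2 * lambda)^-1 by field; rewrite gt_eqF.
rewrite l2; lra.
Qed.
End ProximalPoint.

Lemma rppa_bound (R : realType) (d n : nat) (lambda : R) (F : 'rV[R]_d.+1 -> \bar R) (x0 xs : 'rV[R]_d.+1) :
  (0 < n)%N -> 0 < lambda -> Defs.proper F -> lower_semicontinuous F -> econvex F -> argmin setT F xs ->
  enorm (rppa lambda (h_cst R n) F x0 n - prox lambda F (rppa lambda (h_cst R n) F x0 n)) <= eta_cst R n * enorm (x0 - xs).
Proof.
move=> n0 l0 Fp Fl Fc Fm.
set r := r_cst R n; set h := h_cst R n.
have [r01 rn] := r_cstP R n0; rewrite -/r in r01 rn.
have r0 : 0 <= r ^+ n by rewrite exprn_ge0//; case/andP: r01 => /ltW.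
pose x k := rppa lambda h F x0 k.
pose p k := prox lambda F (x k).
have fp k := prox_fin l0 Fp Fl Fc Fm (x k).
pose c k := fine (F (p k)).
have Fpk k : F (p k) = (c k)%:E by rewrite /c /p; have [e -> _] := fp k.
have sub k w : ((c k + lambda^-1 * dot (x k - p k) (w - p k))%:E <= F w)%E.
  by rewrite /c /p; have [e -> H] := fp k; exact: H.
pose cs := fine (F xs).
have Fxs : F xs = cs%:E.
  rewrite /cs; have [_ mn] := Fm; have := mn (p 0) I; rewrite Fpk.
  by have [/(_ xs) FN _] := Fp; move: FN; case: (F xs).
(* The factor [lambda] in [G] makes the residual [g k] itself play the role of the subgradient at
   [p k]. *)
pose g k := x k - p k; pose z k := p k - xs; pose G k := lambda * (c k - cs).
have li : lambda * lambda^-1 = 1 by rewrite divff// gt_eqF.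
have hz k : z k - z k.+1 = r *: g k + g k.+1.
  have xS : x k.+1 = x k + h *: (p k - x k) by [].
  rewrite /z /g xS /h /h_cst -/r scalerDl scale1r.
  by apply/rowP => i; rewrite !mxE; ring.
have hQ i j : dot (g j) (z i - z j) <= G i - G j.
  have := sub j (p i); rewrite Fpk lee_fin => H.
  have -> : z i - z j = p i - p j by rewrite /z opprB addrA subrK.
  have := ler_wpM2l (ltW l0) H; rewrite mulrDr mulrA li mul1r /G /g; lra.
have hA j : G j <= dot (g j) (z j).
  have := sub j xs; rewrite Fxs lee_fin => H.
  have := ler_wpM2l (ltW l0) H; rewrite mulrDr mulrA li mul1r /G /g /z -(opprB (p j) xs) dotNr; lra.
have hG j : 0 <= G j.
  have [_ mn] := Fm; have := mn (p j) I; rewrite Fpk Fxs lee_fin => H.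
  by rewrite mulr_ge0 ?subr_ge0// ltW.
have := residual_bound hz hQ hA hG r01 rn n0.
have -> : z 0%N + g 0%N = x0 - xs by rewrite /z /g addrC addrA subrK.
by move=> H; apply: enorm_le.
Qed.

(** * Lower bounds from one-dimensional examples *)

Section LineFunctions.
Variable R : realType.
Implicit Types (x y : 'rV[R]_1).

Lemma enorm_dim1 x : enorm x = `|x 0 0|.
Proof. by rewrite /enorm big_ord1 sqrtr_sqr. Qed.

Lemma sub_dim1 x y : (x - y) 0 0 = x 0 0 - y 0 0.
Proof. by rewrite !mxE. Qed.

(** Lets [huber_bounds] give the derivative of the Huber function at every point, the threshold
    included. *)
Lemma is_derive_quadratic_error (phi : R -> R) (a c C : R) : 0 <= C ->
  (forall b, `|phi b - phi a - c * (b - a)| <= C * (b - a) ^+ 2) -> is_derive a 1 phi c.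
Proof.
move=> C0 H.
have cv : (fun h : R => h^-1 *: ((phi \o shift a) (h *: 1) - phi a)) @ 0^' --> c.
  apply/cvgrPdist_le => e e0.
  near=> h.
  have h0 : h != 0 by near: h; exact: nbhs_dnbhs_neq.
  rewrite /= [h%:A]mulr1.
  have -> : c - h^-1 *: (phi (h + a) - phi a) = - (h^-1 * (phi (h + a) - phi a - c * (h + a - a))).
    by rewrite /GRing.scale /= addrK; field.
  rewrite normrN normrM normfV ler_pdivrMl ?normr_gt0//.
  apply: le_trans (H _) _; rewrite addrK.
  have hC : `|h| <= e / (C + 1).
    by near: h; apply: dnbhs0_le; rewrite divr_gt0// ltr_pwDr.
  have C1 : 0 < C + 1 by rewrite ltr_pwDr.
  rewrite -[h ^+ 2]real_normK ?num_real// expr2 mulrCA ler_wpM2l//.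
  rewrite ler_pdivlMr// in hC; apply: le_trans hC.
  by rewrite mulrC ler_wpM2l// lerDl.
by apply: DeriveDef; [apply/cvg_ex; exists c | exact/cvg_lim].
Unshelve. all: by end_near.
Qed.

Definition line_fun (phi : R -> R) : 'rV[R]_1 -> R := fun x => phi (x 0 0).

Lemma line_differentiable (phi : R -> R) x (c : R) : is_derive (x 0 0) 1 phi c ->
  differentiable (line_fun phi) x.
Proof.
move=> dphi; have d1 : differentiable (fun M : 'rV[R]_1 => M 0 0) x.
  exact: differentiable_coord.
apply: (@differentiable_comp _ _ _ _ (fun M : 'rV[R]_1 => M 0 0) phi x d1).
by apply/derivable1_diffP; apply: ex_derive.
Qed.

Lemma line_grad (phi : R -> R) x (c : R) : is_derive (x 0 0) 1 phi c ->
  grad (line_fun phi) x 0 0 = c.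
Proof.
move=> dphi; rewrite mxE.
have E : (fun h : R => h^-1 *: ((line_fun phi \o shift x) (h *: delta_mx 0 0) - line_fun phi x)) =
    (fun h : R => h^-1 *: ((phi \o shift (x 0 0)) (h *: 1) - phi (x 0 0))).
  by apply/funext => h; rewrite /= /line_fun !mxE !eqxx.
by rewrite /derive E; exact: derive_val.
Qed.

(* One-sided Huber function: quadratic below the threshold, affine above it. *)
Definition huber (t s : R) : R := s ^+ 2 / 2 - Num.max (s - t) 0 ^+ 2 / 2.

(** The lower bound yields convexity and the minimizer, and both bounds together the derivative
    [min a t]. *)
Lemma huber_bounds (t a b : R) :
  0 <= huber t b - huber t a - Num.min a t * (b - a) <= (b - a) ^+ 2 / 2.
Proof.
rewrite /huber.
have mE (c : R) : (c <= t -> Num.max (c - t) 0 = 0) /\ (t < c -> Num.max (c - t) 0 = c - t).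
  by split=> ct; [apply/max_idPr|apply/max_idPl]; lra.
have sq (c : R) : 0 <= c ^+ 2 by exact: sqr_ge0.
have [at_|at_] := leP a t; have [bt|bt] := leP b t.
- by rewrite (mE a).1// (mE b).1//; have := sq (b - a); lra.
- rewrite (mE a).1// (mE b).2//; have := sq (b - t); have := sq (t - a).
  have : 0 <= (t - a) * (b - t) by rewrite mulr_ge0// subr_ge0// ltW.
  lra.
- rewrite (mE a).2// (mE b).1//; have := sq (b - t); have := sq (t - a).
  have : 0 <= (a - t) * (t - b) by rewrite mulr_ge0// subr_ge0// ltW.
  lra.
- by rewrite (mE a).2// (mE b).2//; have := sq (b - a); lra.
Qed.

Variables (L : R).
Hypothesis L0 : 0 < L.

Definition huber_fun (t : R) := line_fun (fun s => L * huber t s).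

Let huber_derive (t a : R) : is_derive a 1 (fun s => L * huber t s) (L * Num.min a t).
Proof.
apply: (@is_derive_quadratic_error _ _ _ (L / 2)); first by rewrite divr_ge0// ltW.
move=> b; have := huber_bounds t a b => /andP[H1 H2].
have -> : L * huber t b - L * huber t a - L * Num.min a t * (b - a) =
  L * (huber t b - huber t a - Num.min a t * (b - a)) by ring.
by rewrite normrM (gtr0_norm L0) -mulrA ler_pM2l// ger0_norm// [leRHS]mulrC.
Qed.

Lemma huber_grad (t : R) x : grad (huber_fun t) x 0 0 = L * Num.min (x 0 0) t.
Proof. exact: line_grad. Qed.

Lemma huber_smooth (t : R) : smooth L (huber_fun t).
Proof.
split=> [x|x y]; first exact: line_differentiable.
have gx := huber_grad t x; have gy := huber_grad t y.
rewrite !enorm_dim1 !sub_dim1 gx gy.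
rewrite -mulrBr normrM (gtr0_norm L0) ler_pM2l//.
case: (leP (x 0 0) t) => xt; case: (leP (y 0 0) t) => yt //; rewrite ?subrr ?normr0//.
- rewrite ler0_norm ?ler0_norm; lra.
- rewrite ger0_norm ?ger0_norm; lra.
Qed.

Lemma huber_convex (t : R) : convex_function setT (huber_fun t).
Proof.
move=> p x y _ _.
suff : huber_fun t (p%:num *: x + (1 - p%:num) *: y) <=
    p%:num * huber_fun t x + (1 - p%:num) * huber_fun t y by [].
have p0 : 0 <= p%:num by exact: ge0.
have p1 : p%:num <= 1 by exact: le1.
rewrite /huber_fun /line_fun !mxE.
move: (p%:num) (x 0 0) (y 0 0) p0 p1 => q a b q0 q1.
set c := q * a + (1 - q) * b.
have /andP[H1 _] := huber_bounds t c a.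
have /andP[H2 _] := huber_bounds t c b.
have q1' : 0 <= 1 - q by rewrite subr_ge0.
have := addr_ge0 (mulr_ge0 q0 H1) (mulr_ge0 q1' H2).
move=> H; have {}H := mulr_ge0 (ltW L0) H; rewrite -subr_ge0; apply: le_trans H _.
rewrite le_eqVlt; apply/orP; left; apply/eqP.
by move: (huber t a) (huber t b) (huber t c) (Num.min c t) => u v w m; rewrite /c; ring.
Qed.

Lemma huber_argmin (t : R) : 0 <= t -> argmin setT (huber_fun t) 0.
Proof.
move=> t0; split=> // y _; rewrite /huber_fun /line_fun ler_pM2l// mxE.
have /andP[+ _] := huber_bounds t 0 (y 0 0).
by rewrite (min_idPl t0) mul0r subr0 subr_ge0.
Qed.

Lemma huber_gd (alpha t : R) x k :
  gd L alpha (huber_fun t) x k.+1 0 0 = gd L alpha (huber_fun t) x k 0 0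
   - alpha * Num.min (gd L alpha (huber_fun t) x k 0 0) t.
Proof.
rewrite /= -/(gd _ _ _ _ _); set w := gd _ _ _ _ _.
rewrite !mxE; have := huber_grad t w; rewrite mxE => ->.
by rewrite mulrA divfK// gt_eqF.
Qed.

Variables (n : nat) (alpha : R).
Hypothesis alpha0 : 0 < alpha.
Let one : 'rV[R]_1 := const_mx 1.

Let one_neq0 : one != 0.
Proof. by apply/eqP => /rowP /(_ 0); rewrite !mxE => /eqP; rewrite oner_eq0. Qed.

Lemma huber_quotient (t : R) : 0 <= t ->
  ((`|Num.min (gd L alpha (huber_fun t) one n 0 0) t|)%:E <= Gcrit L n alpha)%E.
Proof.
move=> t0; apply: ereal_sup_ubound.
exists 0, (huber_fun t), one, 0; split=> //.
- exact: huber_convex.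
- exact: huber_smooth.
- exact: huber_argmin.
congr _%:E; rewrite !enorm_dim1 huber_grad subr0 mxE normr1 mulr1.
by rewrite normrM gtr0_norm// mulrAC divff ?mul1r// gt_eqF.
Qed.

Lemma Gcrit_ge_quadratic : ((`|1 - alpha| ^+ n)%:E <= Gcrit L n alpha)%E.
Proof.
(* This threshold is at least [(1 - alpha)^k] for all [k <= n], so on the whole trajectory the Huber
   function coincides with the quadratic. *)
have t1 : 1 <= (1 + `|1 - alpha|) ^+ n by rewrite exprn_ege1// lerDl.
apply: le_trans (huber_quotient (le_trans ler01 t1)).
have E k : (k <= n)%N -> gd L alpha (huber_fun ((1 + `|1 - alpha|) ^+ n)) one k 0 0 = (1 - alpha) ^+ k.
  elim: k => [|k IH] kn; first by rewrite /= mxE expr0.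
  rewrite huber_gd IH ?(ltnW kn)//; rewrite (min_idPl _); first by rewrite exprS; ring.
  apply: le_trans (ler_norm _) _; rewrite normrX.
  apply: (@le_trans _ _ ((1 + `|1 - alpha|) ^+ k)).
    by rewrite lerXn2r ?nnegrE ?addr_ge0// lerDr.
  by rewrite ler_weXn2l ?lerDl// ltnW.
rewrite lee_fin E// (min_idPl _) ?normrX//.
apply: le_trans (ler_norm _) _; rewrite normrX.
by rewrite lerXn2r ?nnegrE ?addr_ge0// lerDr.
Qed.

Lemma Gcrit_ge_huber : (((1 + n%:R * alpha)^-1)%:E <= Gcrit L n alpha)%E.
Proof.
have d0 : 0 < 1 + n%:R * alpha by rewrite ltr_pwDl// mulr_ge0// ltW.
have t0 : 0 <= (1 + n%:R * alpha)^-1 by rewrite invr_ge0 ltW.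
(* With this threshold no iterate up to [n] falls below [t], so every gradient is [L t], and the
   last iterate [1 - n alpha t] is [t] itself. *)
set t := _^-1 in t0 *.
apply: le_trans (huber_quotient t0).
have td : t * (1 + n%:R * alpha) = 1 by rewrite mulVf// gt_eqF.
have le k : (k <= n)%N -> t <= 1 - k%:R * (alpha * t).
  move=> kn; have : k%:R * (alpha * t) <= n%:R * (alpha * t).
    by rewrite ler_wpM2r ?ler_nat// mulr_ge0// ltW.
  move: td; lra.
have E k : (k <= n)%N -> gd L alpha (huber_fun t) one k 0 0 = 1 - k%:R * (alpha * t).
  elim: k => [|k IH] kn; first by rewrite /= mxE mul0r subr0.
  rewrite huber_gd IH ?(ltnW kn)// (min_idPr _); last by apply: le; exact: ltnW.
  by rewrite -natr1; ring.
by rewrite lee_fin E// (min_idPr _) ?le// ger0_norm.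
Qed.
End LineFunctions.

(** The subgradient inequality makes the proximal objective at [w] exceed its value at [p] by at
    least [|w - p|^2 / (2 lambda)]. So [p] is the only minimizer, and [xget] must return it. *)
Lemma prox_unique (R : realType) (d : nat) (lambda : R) (F : 'rV[R]_d.+1 -> \bar R)
    (x p : 'rV[R]_d.+1) (c : R) : 0 < lambda -> F p = c%:E ->
  (forall w, ((c + lambda^-1 * dot (x - p) (w - p))%:E <= F w)%E) -> prox lambda F x = p.
Proof.
move=> l0 Fp sub.
have l2 : lambda^-1 = 2 * (2 * lambda)^-1 by field; rewrite gt_eqF.
have i0 : 0 < (2 * lambda)^-1 by rewrite invr_gt0 mulr_gt0.
have growth w : ((c + (2 * lambda)^-1 * enorm (p - x) ^+ 2 + (2 * lambda)^-1 * dot (w - p) (w - p))%:E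
    <= F w + ((2 * lambda)^-1 * enorm (w - x) ^+ 2)%:E)%E.
  apply: (le_trans _ (leeD2r _ (sub w))); rewrite -EFinD lee_fin l2.
  have -> : w - x = (w - p) + (p - x) by rewrite addrA subrK.
  rewrite -(opprB p x); move: (w - p) (p - x) => a b; rewrite !enorm_sqr !dotE (dotC b a).
  lra.
apply: xget_unique.
  split=> // w _; rewrite Fp -EFinD; apply: le_trans (growth w).
  by rewrite lee_fin lerDl mulr_ge0 ?dot_ge0// ltW.
move=> w [_ /(_ p I)]; rewrite Fp -EFinD => /(le_trans (growth w)).
by rewrite lee_fin gerDl pmulr_rle0// => /dot_le0 /eqP; rewrite subr_eq0 => /eqP.
Qed.

Section ProximalLowerBounds.
Variables (R : realType) (lambda : R).
Hypothesis lambda0 : 0 < lambda.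
Variables (n : nat) (alpha : R).
Hypothesis alpha0 : 0 < alpha.
Let one : 'rV[R]_1 := const_mx 1.
Let one_neq0 : one != 0.
Proof. by apply/eqP => /rowP /(_ 0); rewrite !mxE => /eqP; rewrite oner_eq0. Qed.

Lemma Rcrit_ge (F : 'rV[R]_1 -> \bar R) :
  [/\ Defs.proper F, lower_semicontinuous F & econvex F] -> argmin setT F 0 ->
  ((`|rppa lambda alpha F one n 0 0 - prox lambda F (rppa lambda alpha F one n) 0 0|)%:E
    <= Rcrit lambda n alpha)%E.
Proof.
move=> HF Fm; apply: ereal_sup_ubound => /=; exists 0, F, one, 0; split=> //.
congr _%:E; rewrite !enorm_dim1 !sub_dim1.
by rewrite [one 0 0]mxE [(0 : 'rV[R]_1) 0 0]mxE subr0 normr1 divr1.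
Qed.

Let point (z : 'rV[R]_1) : \bar R := if z == 0 then 0%E else +oo%E.

Lemma Rcrit_ge_point : ((`|1 - alpha| ^+ n)%:E <= Rcrit lambda n alpha)%E.
Proof.
have pge z : (0 <= point z)%E by rewrite /point; case: ifP.
have p0 : point 0 = 0%E by rewrite /point eqxx.
have pr x : prox lambda point x = 0.
  apply: (@prox_unique _ _ _ _ _ _ 0 lambda0 p0) => w; rewrite /point; case: eqP => [->|_].
    by rewrite !subr0 dotC dot0l mulr0 addr0.
  by rewrite leey.
have E k : rppa lambda alpha point one k 0 0 = (1 - alpha) ^+ k.
  elim: k => [|k IH]; first by rewrite /= mxE.
  rewrite /= -/(rppa _ _ _ _ _) pr !mxE IH exprS; ring.
have := @Rcrit_ge point; rewrite pr E mxE subr0 normrX; apply.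
- split.
  + split=> [z|]; first by rewrite /point; case: ifP.
    by exists 0; rewrite p0.
  + move=> x a; rewrite /point; case: eqP => [_ a0|x0 _].
      exists setT; first exact: filterT.
      by move=> y _; apply: lt_le_trans (pge y).
    exists (~` [set 0]).
      apply: open_nbhs_nbhs; split; last by [].
      by apply: closed_openC; apply: accessible_closed_set1; exact: hausdorff_accessible (@norm_hausdorff _ _).
    by move=> y /= /eqP/negPf ->; rewrite ltry.
  + move=> x y t /andP[t0 t1]; have t1' : 0 <= 1 - t by rewrite subr_ge0.
    (* The ends are treated apart because [0 * +oo = 0]; for [0 < t < 1] both factors leave the
       values of [point] unchanged, which is [T]. *)
    have [->|/eqP t0'] := eqVneq t 0.
      by rewrite scale0r add0r subr0 scale1r mul0e add0e mul1e.
    have [->|/eqP t1''] := eqVneq t 1.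
      by rewrite subrr scale0r addr0 scale1r mul0e adde0 mul1e.
    have tp : 0 < t by rewrite lt_neqAle t0 andbT eq_sym; apply/eqP.
    have tp' : 0 < 1 - t by rewrite subr_gt0 lt_neqAle t1 andbT; apply/eqP.
    have T (s : R) z : 0 < s -> (s%:E * point z)%E = point z.
      by move=> s0; rewrite /point; case: ifP; rewrite ?mule0// gt0_muley// lte_fin.
    rewrite !T//; rewrite {2 3}/point.
    case: eqP => [->|_]; last by case: ifP; rewrite ?addye// leey.
    case: eqP => [->|_]; last by rewrite addey// leey.
    by rewrite !scaler0 addr0 p0 adde0.
- by split=> // y _; rewrite p0.
Qed.

Let slope (tau : R) (z : 'rV[R]_1) : \bar R := (tau * Num.max (z 0 0) 0)%:E.

Lemma Rcrit_ge_slope : (((1 + n%:R * alpha)^-1)%:E <= Rcrit lambda n alpha)%E.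
Proof.
have d0 : 0 < 1 + n%:R * alpha by rewrite ltr_pwDl// mulr_ge0// ltW.
have s0 : 0 < (1 + n%:R * alpha)^-1 by rewrite invr_gt0.
(* With slope [s / lambda] the proximal map subtracts [s] from any point at or above [s]. Each
   iteration thus subtracts [alpha s], and the last iterate [1 - n alpha s] is [s] itself. *)
set s := _^-1 in s0 *; set tau := s / lambda.
have tau0 : 0 < tau by rewrite divr_gt0.
have sd : s * (1 + n%:R * alpha) = 1 by rewrite mulVf// gt_eqF.
have pr (x : 'rV[R]_1) : s <= x 0 0 -> prox lambda (slope tau) x = x - const_mx s.
  move=> sx; have px : (x - const_mx s) 0 0 = x 0 0 - s by rewrite !mxE.
  have Fp : slope tau (x - const_mx s) = (tau * (x 0 0 - s))%:E.
    by rewrite /slope px (max_idPl _)// subr_ge0.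
  apply: (prox_unique lambda0 Fp) => w.
  rewrite lee_fin /dot big_ord1 !sub_dim1 !mxE.
  have -> : tau * (x 0 0 - s) + lambda^-1 * ((x 0 0 - (x 0 0 - s)) * (w 0 0 - (x 0 0 - s))) =
    tau * w 0 0 by rewrite /tau; ring.
  by rewrite ler_pM2l// le_max lexx.
have le k : (k <= n)%N -> s <= 1 - k%:R * (alpha * s).
  move=> kn; have : k%:R * (alpha * s) <= n%:R * (alpha * s).
    by rewrite ler_wpM2r ?ler_nat// mulr_ge0// ltW.
  move: sd; lra.
have E k : (k <= n)%N -> rppa lambda alpha (slope tau) one k 0 0 = 1 - k%:R * (alpha * s).
  elim: k => [|k IH] kn; first by rewrite /= mxE mul0r subr0.
  have {}IH := IH (ltnW kn).
  rewrite /= -/(rppa _ _ _ _ _) pr ?IH ?le ?(ltnW kn)//.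
  by rewrite !mxE IH -natr1; ring.
have := @Rcrit_ge (slope tau); rewrite pr ?E ?le// !mxE E// opprB addrC subrK (gtr0_norm s0); apply.
- split.
  + by split=> [z|]; rewrite /slope//; exists 0.
  + move=> x a; rewrite /slope lte_fin => ax.
    have C : (fun z : 'rV[R]_1 => tau * Num.max (z 0 0) 0) @ x --> tau * Num.max (x 0 0) 0.
      have M : (fun z : 'rV[R]_1 => Num.max (z 0 0) 0) @ x --> Num.max (x 0 0) 0.
        have C0 : (fun z : 'rV[R]_1 => z 0 0) @ x --> x 0 0 := @coord_continuous R 1 1 0 0 x.
        have C1 := cvgM (cvgD C0 (cvg_norm C0)) (cvg_cst (2^-1 : R)).
        have max0 (b : R) : Num.max b 0 = (b + `|b|) * 2^-1 by rewrite maxr_absE addr0 subr0.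
        rewrite max0 (_ : (fun z : 'rV[R]_1 => Num.max (z 0 0) 0) =
          (fun z => (z 0 0 + `|z 0 0|) * 2^-1)); last by apply/funext => z; rewrite max0.
        exact: C1.
      exact: (cvgM (cvg_cst tau) M).
    exists [set z : 'rV[R]_1 | a < tau * Num.max (z 0 0) 0]; first exact: (cvgr_gt _ C _ ax).
    by move=> y /=; rewrite lte_fin.
  + move=> x y t /andP[t0 t1]; rewrite -!EFinM -EFinD lee_fin !mxE.
    have t1' : 0 <= 1 - t by rewrite subr_ge0.
    rewrite mulrCA [X in _ <= _ + X]mulrCA -mulrDr ler_pM2l// ge_max.
    apply/andP; split; last by rewrite addr_ge0// mulr_ge0// le_max lexx orbT.
    by apply: lerD; rewrite ler_wpM2l// le_max lexx.
- split=> // y _; rewrite lee_fin mxE maxxx mulr0 mulr_ge0 ?(ltW tau0)//.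
  by rewrite le_max lexx orbT.
Qed.
End ProximalLowerBounds.

(** * Upper and lower bounds combined *)

Lemma enorm_sub_gt0 (R : realType) (d : nat) (x y : 'rV[R]_d.+1) : x != y -> 0 < enorm (x - y).
Proof.
move=> xy; rewrite lt_neqAle enorm_ge0 andbT eq_sym; apply: contraNneq xy => e0.
by rewrite -subr_eq0; apply/eqP/dot_le0; rewrite -enorm_sqr e0 expr0n.
Qed.

Lemma Gcrit_le (R : realType) (L : R) (n : nat) : 0 < L -> (0 < n)%N ->
  (Gcrit L n (h_cst R n) <= (eta_cst R n)%:E)%E.
Proof.
move=> L0 n0; apply: ge_ereal_sup => q [d [f [x0 [xs [fc fs fm x0s ->]]]]].
rewrite lee_fin ler_pdivrMr ?mulr_gt0 ?enorm_sub_gt0//.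
exact: gd_bound.
Qed.

Lemma Rcrit_le (R : realType) (lambda : R) (n : nat) : 0 < lambda -> (0 < n)%N ->
  (Rcrit lambda n (h_cst R n) <= (eta_cst R n)%:E)%E.
Proof.
move=> l0 n0; apply: ge_ereal_sup => q [d [F [x0 [xs [[Fp Fl Fc] Fm x0s ->]]]]].
rewrite lee_fin ler_pdivrMr ?enorm_sub_gt0//.
exact: rppa_bound.
Qed.

(* The two lower bounds cross exactly at [h_cst], where both equal [eta_cst]. *)
Lemma inf_argmin_step (R : realType) (n : nat) (V : R -> \bar R) : (0 < n)%N ->
  (forall a : R, 0 < a -> (((1 + n%:R * a)^-1)%:E <= V a)%E) ->
  (forall a : R, ((`|1 - a| ^+ n)%:E <= V a)%E) ->
  (V (h_cst R n) <= (eta_cst R n)%:E)%E ->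
  ereal_inf [set V a | a in [set a : R | 0 < a]] = (eta_cst R n)%:E /\
  argmin [set a : R | 0 < a] V = [set h_cst R n].
Proof.
move=> n0 Vhuber Vquad Vh.
have [/andP[r0 r1] _] := r_cstP R n0.
have h0 : 0 < h_cst R n by rewrite addr_gt0.
have n0' : 0 < n%:R :> R by rewrite ltr0n.
have etaE := eta_cstE R n0; rewrite div1r in etaE.
have Vgt a : 0 < a -> a != h_cst R n -> ((eta_cst R n)%:E < V a)%E.
  move=> a0; rewrite neq_lt => /orP[ah|ha].
    apply: lt_le_trans (Vhuber a a0); rewrite lte_fin etaE.
    have d0 (b : R) : 0 < b -> 0 < 1 + n%:R * b by move=> b0; rewrite addr_gt0// mulr_gt0.
    by rewrite ltf_pV2 ?posrE ?d0// ltrD2l ltr_pM2l.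
  apply: lt_le_trans (Vquad a); rewrite lte_fin /eta_cst.
  rewrite ltrXn2r ?nnegrE//; first by rewrite -lt0n.
    exact: ltW.
  by rewrite distrC; apply: lt_le_trans (ler_norm _); move: ha; rewrite /h_cst; lra.
have Veta : V (h_cst R n) = (eta_cst R n)%:E.
  by apply/eqP; rewrite eq_le Vh/= etaE Vhuber.
have Vge a : 0 < a -> ((eta_cst R n)%:E <= V a)%E.
  by move=> a0; have [->|/(Vgt a a0)/ltW] := eqVneq a (h_cst R n); rewrite ?Veta.
split.
  apply/eqP; rewrite eq_le; apply/andP; split.
    by rewrite -Veta; apply: ereal_inf_lbound; exists (h_cst R n).
  by apply: le_ereal_inf_tmp => _ [a a0 <-]; exact: Vge.
apply/seteqP; split=> [a [a0 am]|_ ->] /=.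
  apply/eqP/negPn/negP => /(Vgt a a0); apply/negP; rewrite -leNgt -Veta.
  exact: am.
by split=> // a a0; rewrite Veta; exact: Vge.
Qed.

Theorem theorem3 (R : realType) (L lambda : R) (n : nat)
    (hL : 0 < L) (hlambda : 0 < lambda) (hn : (1 <= n)%N) :
  [/\ ereal_inf [set Gcrit L n alpha | alpha in [set a : R | 0 < a]]
        = (eta_cst R n)%:E,
      argmin [set a : R | 0 < a] (Gcrit L n) = [set h_cst R n],
      ereal_inf [set Rcrit lambda n alpha | alpha in [set a : R | 0 < a]]
        = (eta_cst R n)%:E
    & argmin [set a : R | 0 < a] (Rcrit lambda n) = [set h_cst R n]].
Proof.
have [G1 G2] := inf_argmin_step hn (Gcrit_ge_huber hL n) (Gcrit_ge_quadratic hL n) (Gcrit_le hL hn).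
have [R1 R2] := inf_argmin_step hn (Rcrit_ge_slope hlambda n) (Rcrit_ge_point hlambda n) (Rcrit_le hlambda hn).
by split.
Qed.
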